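(* Let $R:(-1,1)\to(0,\infty)$ be a smooth function that is increasing in $(-1,0)$ and decreasing in $(0,1)$, and let $f$ be a real $R$-harmonic mapping of the unit disk $\mathbb{D}$ into the interval $(-1,1)$. Then $$|\nabla f(z)|\le 2\,\frac{1-|f(z)|}{1-|z|^2}\quad\text{for all } z\in\mathbb{D},$$ and this inequality is sharp (the constant $2$ cannot be replaced by a smaller constant valid for all such $R$ and $f$). If moreover $f(0)=0$ and $\int_{-1}^0R(t)\,dt=\int_0^1R(t)\,dt$, then $$|f(z)|\le\frac{4}{\pi}\tan^{-1}|z|\quad\text{for all } z\in\mathbb{D},$$ and this inequality is sharp (for each $z\in\mathbb{D}$ the right-hand side cannot be replaced by a smaller number valid for all such $R$ and $f$).
   Context: $\mathbb{D}=\{z\in\mathbb{C}:|z|<1\}$. For a smooth positive function $R$ on $(-1,1)$ (viewed as the conformal metric density $\rho(u,v)=R(u)$ on the strip $(-1,1)\times\mathbb{R}$), a real-valued $\mathcal{C}^2$ function $f:\mathbb{D}\to(-1,1)$ is called (real) $R$-harmonic if $$\Delta f+\frac{R'(f)}{R(f)}|\nabla f|^2=0\quad\text{on }\mathbb{D},$$ where $\Delta$ and $\nabla$ are the Euclidean Laplacian and gradient. ''Increasing'' and ''decreasing'' are understood in the weak sense (so that the Euclidean case $R\equiv1$ is allowed). *)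

(* Defs.v *)
From Stdlib Require Import Reals.
From Coquelicot Require Import Coquelicot.
Open Scope R_scope.

(* Functions on the interval (-1,1) and on the unit disk are total functions
   of which only the values on those open sets are ever constrained. *)

Definition in_disk (z : C) : Prop := Cmod z < 1.

Definition smooth_density (rho : R -> R) : Prop :=
  (forall t : R, -1 < t < 1 -> 0 < rho t) /\
  (forall (n : nat) (t : R), -1 < t < 1 -> ex_derive_n rho n t).

Definition increasing_on (g : R -> R) (a b : R) : Prop :=
  forall s t : R, a < s -> s <= t -> t < b -> g s <= g t.

Definition decreasing_on (g : R -> R) (a b : R) : Prop :=
  forall s t : R, a < s -> s <= t -> t < b -> g t <= g s.

Definition unimodal_density (rho : R -> R) : Prop :=
  smooth_density rho /\ increasing_on rho (-1) 0 /\ decreasing_on rho 0 1.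

Definition partial_x (f : C -> R) (z : C) : R :=
  Derive (fun x => f (x, Im z)) (Re z).

Definition partial_y (f : C -> R) (z : C) : R :=
  Derive (fun y => f (Re z, y)) (Im z).

Definition laplacian (f : C -> R) (z : C) : R :=
  Derive_n (fun x => f (x, Im z)) 2 (Re z) +
  Derive_n (fun y => f (Re z, y)) 2 (Im z).

Definition grad_norm (f : C -> R) (z : C) : R :=
  sqrt (partial_x f z ^ 2 + partial_y f z ^ 2).

Definition C2_on_disk (f : C -> R) : Prop :=
  forall z : C, in_disk z -> ex_diff_n (fun x y => f (x, y)) 2 (Re z) (Im z).

Definition real_harmonic (rho : R -> R) (f : C -> R) : Prop :=
  (forall z : C, in_disk z -> -1 < f z < 1) /\
  C2_on_disk f /\
  (forall z : C, in_disk z ->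
     laplacian f z + Derive rho (f z) / rho (f z) * grad_norm f z ^ 2 = 0).

Definition admissible (rho : R -> R) (f : C -> R) : Prop :=
  unimodal_density rho /\ real_harmonic rho f.

(* A unimodal density is monotone and bounded on (-1,0) and on (0,1), so both
   Riemann integrals exist, whatever the values of rho at -1 and 1. *)
Definition balanced (rho : R -> R) : Prop :=
  RInt rho (-1) 0 = RInt rho 0 1.

Definition admissible_normalized (rho : R -> R) (f : C -> R) : Prop :=
  admissible rho f /\ f (RtoC 0) = 0 /\ balanced rho.

(* Main.v *)
Require Import Defs.
From Stdlib Require Import Reals Lra Psatz.
From Coquelicot Require Import Coquelicot.
Open Scope R_scope.

(** Let G be a primitive of rho.  The equation for f says exactly that G o f is
    harmonic in the ordinary sense, because
    Delta (G o f) = rho(f) (Delta f + rho'(f)/rho(f) |grad f|^2)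
    ([real_harmonic_linearization]).  Since rho is integrable on (-1,1), G can be
    normalized to an increasing H from [-1,1] onto itself
    ([normalized_primitive]), and everything reduces to a harmonic function
    u = H o f from the disk into (-1,1).

    The one estimate about harmonic functions that is needed is the sharp
    Schwarz-Pick inequality
    (1 - |z|^2) |grad u(z)| <= (4/pi) cos(pi u(z)/2)
    ([harmonic_gradient_bound]).  At z = 0 it comes from two circle averages:
    the mean of u over the circle of radius r is u(0), and its first cosine
    moment is pi r u_x(0).  Among functions with values in [-1,1] and a given
    mean, the moment is largest for the two-valued function that equals 1 on an
    arc around the angle 0 and -1 elsewhere ([bathtub]), which gives the cosine.
    Precomposing with a Moebius automorphism of the disk moves the center to any
    point and turns the gradient into any direction.

    Monotonicity of rho translates these facts back to f.  If f(z) >= 0, then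
    H' = k rho decreases on [f(z),1), so 1 - H(f(z)) <= k rho(f(z)) (1 - f(z)), while
    cos(pi u/2) <= (pi/2)(1 - u); dividing by k rho(f(z)) leaves the gradient
    estimate.  If moreover the two halves of the interval have equal mass, H
    fixes -1, 0 and 1 and is convex on (-1,0) and concave on (0,1), so
    |H(t)| >= |t|; and integrating the Schwarz-Pick inequality along a radius bounds
    |H(f(z))| by (4/pi) atan |z| ([harmonic_schwarz]).

    Both constants are attained in the limit, or exactly, with rho = 1 and the
    conformal strip function (4/pi) Re arctan z, which on the real radius is
    (4/pi) atan t. *)

(** * Complex derivatives of functions of two real variables *)

(** The derivative is recorded as l = u_x - i u_y, twice the Wirtinger derivative
    of u with respect to z.  In this form u is harmonic iff l is holomorphic as a
    function of z, and the chain rule for a holomorphic change of variable is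
    multiplication of l by the complex derivative. *)
Definition wirtinger (u : C -> R) (z l : C) : Prop :=
  differentiable_pt_lim (fun x y => u (x, y)) (Re z) (Im z) (Re l) (- Im l).

(** Complex differentiability at z with derivative l, split into real parts so
    that it can be fed to the real calculus of two variables: the second clause
    holds because Im g = Re (- i g). *)
Definition holo (g : C -> C) (z l : C) : Prop :=
  wirtinger (fun w => Re (g w)) z l /\ wirtinger (fun w => Im (g w)) z (- (Ci * l))%C.

Definition continuous_C (g : C -> C) (z : C) : Prop :=
  continuity_2d_pt (fun x y => Re (g (x, y))) (Re z) (Im z) /\
  continuity_2d_pt (fun x y => Im (g (x, y))) (Re z) (Im z).

Lemma continuity_2d_pt_comp (f X Y : R -> R -> R) (x y : R) :
  continuity_2d_pt f (X x y) (Y x y) ->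
  continuity_2d_pt X x y -> continuity_2d_pt Y x y ->
  continuity_2d_pt (fun a b => f (X a b) (Y a b)) x y.
Proof.
  intros Hf HX HY eps.
  destruct (Hf eps) as [d Hd].
  generalize (locally_2d_and _ _ _ _ (HX d) (HY d)).
  apply locally_2d_impl, locally_2d_forall.
  intros a b [Ha Hb]. now apply Hd.
Qed.

Lemma differentiable_pt_lim_eq (f : R -> R -> R) (x y a b a' b' : R) :
  differentiable_pt_lim f x y a b -> a = a' -> b = b' ->
  differentiable_pt_lim f x y a' b'.
Proof. now intros H <- <-. Qed.

Lemma is_derive_eq (f : R -> R) (x l l' : R) :
  is_derive f x l -> l = l' -> is_derive f x l'.
Proof. now intros H <-. Qed.

Lemma continuity_2d_pt_comp_1d (f : R -> R) (g : R -> R -> R) (x y : R) :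
  continuous f (g x y) -> continuity_2d_pt g x y ->
  continuity_2d_pt (fun a b => f (g a b)) x y.
Proof.
  intros Hf. apply continuity_1d_2d_pt_comp. now apply continuity_pt_filterlim.
Qed.

Lemma continuity_2d_pt_slice (f : R -> R -> R) (x y : R) :
  continuity_2d_pt f x y -> continuous (fun t => f x t) y.
Proof.
  intros Hf P [eps HP].
  destruct (Hf eps) as [d Hd]. exists d. intros t Ht. apply HP.
  apply Hd. 2: exact Ht.
  rewrite Rminus_eq_0, Rabs_R0. apply cond_pos.
Qed.

Lemma wirtinger_curve (u : C -> R) (l : C) (X Y : R -> R) (t dx dy : R) :
  wirtinger u (X t, Y t) l -> is_derive X t dx -> is_derive Y t dy ->
  is_derive (fun s => u (X s, Y s)) t (Re l * dx - Im l * dy).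
Proof.
  intros Hu HX HY. apply is_derive_Reals in HX. apply is_derive_Reals in HY.
  apply is_derive_eq with (Re l * dx + - Im l * dy); [|ring].
  apply is_derive_Reals.
  exact (derivable_pt_lim_comp_2d _ _ _ _ _ _ _ _ Hu HX HY).
Qed.

Lemma wirtinger_continuity (u : C -> R) (z l : C) :
  wirtinger u z l -> continuity_2d_pt (fun x y => u (x, y)) (Re z) (Im z).
Proof.
  intros H. apply differentiable_continuity_pt. eexists. eexists. exact H.
Qed.

Lemma C_eq (z w : C) : Re z = Re w -> Im z = Im w -> z = w.
Proof. destruct z, w. simpl. now intros -> ->. Qed.

Ltac C_ring := apply C_eq; unfold Re, Im; simpl; ring.

Lemma wirtinger_eq (u : C -> R) (z l m : C) :
  wirtinger u z l -> l = m -> wirtinger u z m.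
Proof. now intros H <-. Qed.

Lemma wirtinger_ext (u v : C -> R) (z l : C) :
  (forall w, u w = v w) -> wirtinger u z l -> wirtinger v z l.
Proof.
  intros E. apply differentiable_pt_lim_ext, locally_2d_forall. intros x y. apply E.
Qed.

Lemma differentiable_pt_lim_mult (x y : R) :
  differentiable_pt_lim Rmult x y y x.
Proof.
  intros eps. exists eps. intros u v Hu Hv.
  replace (u * v - x * y - (y * (u - x) + x * (v - y))) with ((u - x) * (v - y))
    by ring.
  rewrite Rabs_mult. apply Rmult_le_compat; auto using Rabs_pos.
  - now apply Rlt_le.
  - apply Rmax_r.
Qed.

Lemma differentiable_pt_lim_linear (c d x y : R) :
  differentiable_pt_lim (fun a b => c * a + d * b) x y c d.
Proof.
  intros eps. exists eps. intros u v Hu Hv.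
  replace (c * u + d * v - (c * x + d * y) - (c * (u - x) + d * (v - y))) with 0
    by ring.
  rewrite Rabs_R0. apply Rmult_le_pos; [apply Rlt_le, cond_pos|].
  apply Rle_trans with (1 := Rabs_pos (u - x)), Rmax_l.
Qed.

Lemma wirtinger_const (c : R) (z : C) : wirtinger (fun _ => c) z 0.
Proof.
  intros eps. exists eps. intros u v _ _.
  replace (c - c - _) with 0 by (simpl; ring).
  rewrite Rabs_R0. apply Rmult_le_pos; [apply Rlt_le, cond_pos|].
  apply Rle_trans with (1 := Rabs_pos (u - Re z)), Rmax_l.
Qed.

Lemma wirtinger_mult (u v : C -> R) (z l m : C) :
  wirtinger u z l -> wirtinger v z m ->
  wirtinger (fun w => u w * v w) z (v z * l + u z * m)%C.
Proof.
  intros Hu Hv. destruct z as [x y].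
  refine (differentiable_pt_lim_eq _ _ _ _ _ _ _
    (differentiable_pt_lim_comp _ _ _ _ _ _ _ _ _ _ _
      (differentiable_pt_lim_mult _ _) Hu Hv) _ _); unfold Re, Im; simpl; ring.
Qed.

Lemma wirtinger_linear (c d : R) (u v : C -> R) (z l m : C) :
  wirtinger u z l -> wirtinger v z m ->
  wirtinger (fun w => c * u w + d * v w) z (c * l + d * m)%C.
Proof.
  intros Hu Hv. destruct z as [x y].
  refine (differentiable_pt_lim_eq _ _ _ _ _ _ _
    (differentiable_pt_lim_comp _ _ _ _ _ _ _ _ _ _ _
      (differentiable_pt_lim_linear c d _ _) Hu Hv) _ _); unfold Re, Im; simpl; ring.
Qed.

Lemma wirtinger_scal (c : R) (u : C -> R) (z l : C) :
  wirtinger u z l -> wirtinger (fun w => c * u w) z (c * l)%C.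
Proof.
  intros Hu. apply (wirtinger_ext (fun w => c * u w + 0 * u w)).
  - intros. ring.
  - apply wirtinger_eq with (1 := wirtinger_linear c 0 u u z l l Hu Hu). C_ring.
Qed.

Lemma wirtinger_real_comp (h : R -> R) (h' : R) (u : C -> R) (z l : C) :
  is_derive h (u z) h' -> wirtinger u z l -> wirtinger (fun w => h (u w)) z (h' * l)%C.
Proof.
  intros Hh Hu. destruct z as [x y]. apply is_derive_Reals in Hh.
  refine (differentiable_pt_lim_eq _ _ _ _ _ _ _
    (differentiable_pt_lim_comp _ _ _ _ _ _ _ _ _ _ _
      (differentiable_pt_lim_proj1_0 _ _ 0 _ Hh) Hu (wirtinger_const 0 (x, y))) _ _);
  unfold Re, Im; simpl; ring.
Qed.

Lemma wirtinger_comp (u : C -> R) (phi : C -> C) (z l m : C) :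
  wirtinger u (phi z) l -> holo phi z m -> wirtinger (fun w => u (phi w)) z (l * m)%C.
Proof.
  intros Hu [H1 H2]. destruct z as [x y].
  apply (wirtinger_ext (fun w => u (Re (phi w), Im (phi w)))).
  { intros w. now rewrite <- surjective_pairing. }
  refine (differentiable_pt_lim_eq _ _ _ _ _ _ _
    (differentiable_pt_lim_comp (fun x y => u (x, y)) _ _ _ _ _ _ _ _ _ _
       Hu H1 H2) _ _); unfold Re, Im; simpl; ring.
Qed.

Lemma holo_eq (g : C -> C) (z l m : C) : holo g z l -> l = m -> holo g z m.
Proof. now intros H <-. Qed.

Lemma holo_comp (g phi : C -> C) (z l m : C) :
  holo g (phi z) l -> holo phi z m -> holo (fun w => g (phi w)) z (l * m)%C.
Proof.
  intros [H1 H2] Hp. split.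
  - exact (wirtinger_comp _ _ _ _ _ H1 Hp).
  - apply wirtinger_eq with (1 := wirtinger_comp _ _ _ _ _ H2 Hp). C_ring.
Qed.

Lemma holo_mult (g h : C -> C) (z l m : C) :
  holo g z l -> holo h z m -> holo (fun w => g w * h w)%C z (l * h z + g z * m)%C.
Proof.
  intros [G1 G2] [H1 H2]. split.
  - apply (wirtinger_ext (fun w => 1 * (Re (g w) * Re (h w)) + -1 * (Im (g w) * Im (h w)))).
    { intros w. unfold Re, Im; simpl. ring. }
    refine (wirtinger_eq _ _ _ _ (wirtinger_linear 1 (-1) _ _ _ _ _
      (wirtinger_mult _ _ _ _ _ G1 H1) (wirtinger_mult _ _ _ _ _ G2 H2)) _).
    C_ring.
  - apply (wirtinger_ext (fun w => 1 * (Re (g w) * Im (h w)) + 1 * (Im (g w) * Re (h w)))).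
    { intros w. unfold Re, Im; simpl. ring. }
    refine (wirtinger_eq _ _ _ _ (wirtinger_linear 1 1 _ _ _ _ _
      (wirtinger_mult _ _ _ _ _ G1 H2) (wirtinger_mult _ _ _ _ _ G2 H1)) _).
    C_ring.
Qed.

Lemma holo_affine (a b z : C) : holo (fun w => a + b * w)%C z b.
Proof.
  destruct a as [a1 a2], b as [b1 b2], z as [x y].
  split; intros eps; exists eps; intros u v _ _;
  match goal with |- Rabs ?X <= _ => replace X with 0 by (unfold Re, Im; simpl; ring) end;
  rewrite Rabs_R0; (apply Rmult_le_pos; [apply Rlt_le, cond_pos|]);
  match goal with |- _ <= Rmax (Rabs ?X) _ =>
    apply Rle_trans with (1 := Rabs_pos X), Rmax_l end.
Qed.

Lemma holo_ext (g h : C -> C) (z l : C) :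
  (forall w, g w = h w) -> holo g z l -> holo h z l.
Proof.
  intros E [H1 H2].
  split; [apply wirtinger_ext with (2 := H1) | apply wirtinger_ext with (2 := H2)];
    intros w; now rewrite E.
Qed.

Lemma holo_id (z : C) : holo (fun w => w) z 1.
Proof. apply holo_ext with (2 := holo_affine 0 1 z). intros w. ring. Qed.

Lemma holo_const (c z : C) : holo (fun _ => c) z 0.
Proof. apply holo_ext with (2 := holo_affine c 0 z). intros w. ring. Qed.

Lemma holo_inv (g : C -> C) (z l : C) :
  g z <> RtoC 0 -> holo g z l -> holo (fun w => / g w)%C z (- (l * (/ g z * / g z)))%C.
Proof.
  intros Hz [H1 H2].
  set (n := fun w => Re (g w) ^ 2 + Im (g w) ^ 2).
  assert (Hn : n z <> 0).
  { intros E. apply Hz. unfold n in E. apply C_eq; simpl; nra. }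
  assert (Hn' : fst (g z) * fst (g z) + snd (g z) * snd (g z) <> 0).
  { intros E. apply Hn. unfold n, Re, Im. rewrite <- E. ring. }
  assert (Dn : wirtinger n z (2 * Re (g z) * l - 2 * Im (g z) * (Ci * l))%C).
  { apply (wirtinger_ext (fun w => 1 * (Re (g w) * Re (g w)) + 1 * (Im (g w) * Im (g w)))).
    { intros w. unfold n. ring. }
    refine (wirtinger_eq _ _ _ _ (wirtinger_linear 1 1 _ _ _ _ _
      (wirtinger_mult _ _ _ _ _ H1 H1) (wirtinger_mult _ _ _ _ _ H2 H2)) _).
    C_ring. }
  assert (Di : wirtinger (fun w => / n w) z
    (RtoC (- / n z ^ 2) * (2 * Re (g z) * l - 2 * Im (g z) * (Ci * l)))%C).
  { apply (wirtinger_real_comp Rinv); trivial.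
    auto_derive; trivial. field. trivial. }
  split.
  - refine (wirtinger_eq _ _ _ _ (wirtinger_mult _ _ _ _ _ H1 Di) _).
    apply C_eq; unfold n, Re, Im; simpl; field; exact Hn'.
  - apply (wirtinger_ext (fun w => -1 * (Im (g w) * / n w))).
    { intros w. unfold n, Re, Im; simpl. unfold Rdiv. ring. }
    refine (wirtinger_eq _ _ _ _ (wirtinger_scal (-1) _ _ _
      (wirtinger_mult _ _ _ _ _ H2 Di)) _).
    apply C_eq; unfold n, Re, Im; simpl; field; exact Hn'.
Qed.

Lemma holo_continuous_C (g : C -> C) (z l : C) : holo g z l -> continuous_C g z.
Proof.
  intros [H1 H2]. split.
  - exact (wirtinger_continuity _ _ _ H1).
  - exact (wirtinger_continuity _ _ _ H2).
Qed.

Lemma continuous_C_plus (g h : C -> C) (z : C) :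
  continuous_C g z -> continuous_C h z -> continuous_C (fun w => g w + h w)%C z.
Proof.
  intros [G1 G2] [H1 H2]. split; now apply continuity_2d_pt_plus.
Qed.

Lemma continuous_C_mult (g h : C -> C) (z : C) :
  continuous_C g z -> continuous_C h z -> continuous_C (fun w => g w * h w)%C z.
Proof.
  intros [G1 G2] [H1 H2]. split.
  - apply continuity_2d_pt_minus; now apply continuity_2d_pt_mult.
  - apply continuity_2d_pt_plus; now apply continuity_2d_pt_mult.
Qed.

Lemma continuous_C_comp (g phi : C -> C) (z : C) :
  continuous_C g (phi z) -> continuous_C phi z -> continuous_C (fun w => g (phi w)) z.
Proof.
  intros [G1 G2] [H1 H2]. destruct z as [x y]. split.
  - apply continuity_2d_pt_ext with
      (fun x y => Re (g (Re (phi (x, y)), Im (phi (x, y))))).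
    { intros a b. now rewrite <- surjective_pairing. }
    now apply (continuity_2d_pt_comp (fun x y => Re (g (x, y)))).
  - apply continuity_2d_pt_ext with
      (fun x y => Im (g (Re (phi (x, y)), Im (phi (x, y))))).
    { intros a b. now rewrite <- surjective_pairing. }
    now apply (continuity_2d_pt_comp (fun x y => Im (g (x, y)))).
Qed.

(** * Integrals over concentric circles *)

Definition circle (r t : R) : C := (r * cos t, r * sin t).

Lemma in_disk_Re_Im (z : C) : in_disk z <-> Re z ^ 2 + Im z ^ 2 < 1.
Proof.
  unfold in_disk, Cmod, Re, Im. split; intros H.
  - rewrite <- (Rmult_1_r 1). rewrite <- (sqrt_sqrt (fst z ^ 2 + snd z ^ 2)) by nra.
    apply Rmult_le_0_lt_compat; auto using sqrt_pos.
  - rewrite <- sqrt_1. apply sqrt_lt_1; nra.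
Qed.

Lemma circle_in_disk (r t : R) : Rabs r < 1 -> in_disk (circle r t).
Proof.
  intros Hr. apply in_disk_Re_Im. unfold circle, Re, Im; simpl fst; simpl snd.
  replace ((r * cos t) ^ 2 + (r * sin t) ^ 2) with (r² * ((sin t)² + (cos t)²))
    by (unfold Rsqr; ring).
  rewrite sin2_cos2. apply Rabs_def2 in Hr. unfold Rsqr. nra.
Qed.

Lemma circle_0 (t : R) : circle 0 t = RtoC 0.
Proof. unfold circle, RtoC. now rewrite !Rmult_0_l. Qed.

Lemma continuity_2d_pt_angle (w : R -> R) (r t : R) :
  continuous w t -> continuity_2d_pt (fun _ t => w t) r t.
Proof.
  intros Hw. apply (continuity_2d_pt_comp_1d w (fun _ t => t)); trivial.
  apply continuity_2d_pt_id2.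
Qed.
Lemma continuity_2d_pt_circle (f : C -> R) (r t : R) :
  continuity_2d_pt (fun x y => f (x, y)) (r * cos t) (r * sin t) ->
  continuity_2d_pt (fun r t => f (circle r t)) r t.
Proof.
  intros Hf.
  apply (continuity_2d_pt_comp (fun x y => f (x, y))
           (fun r t => r * cos t) (fun r t => r * sin t)); trivial;
    apply continuity_2d_pt_mult; try apply continuity_2d_pt_id1.
  - apply continuity_2d_pt_angle, continuous_cos.
  - apply continuity_2d_pt_angle, continuous_sin.
Qed.

Lemma locally_Rabs_lt (r : R) : Rabs r < 1 -> locally r (fun s : R => Rabs s < 1).
Proof.
  intros Hr. apply Rabs_def2 in Hr.
  assert (H : 0 < Rmin (1 - r) (1 + r)) by (apply Rmin_case; lra).
  exists (mkposreal _ H). intros s Hs. apply Rabs_def2 in Hs. simpl in Hs.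
  unfold minus, plus, opp in Hs; simpl in Hs.
  pose proof (Rmin_l (1 - r) (1 + r)). pose proof (Rmin_r (1 - r) (1 + r)).
  apply Rabs_def1; lra.
Qed.

Lemma is_derive_circle_radius (u : C -> R) (l : C) (r t : R) :
  wirtinger u (circle r t) l ->
  is_derive (fun s => u (circle s t)) r (Re l * cos t - Im l * sin t).
Proof.
  intros H.
  apply (wirtinger_curve u l (fun s => s * cos t) (fun s => s * sin t)); trivial.
  - auto_derive; trivial; ring.
  - auto_derive; trivial; ring.
Qed.

Lemma is_derive_circle_angle (u : C -> R) (l : C) (r t : R) :
  wirtinger u (circle r t) l ->
  is_derive (fun s => u (circle r s)) t (- r * (Re l * sin t + Im l * cos t)).
Proof.
  intros H.
  apply is_derive_eq with (Re l * (- (r * sin t)) - Im l * (r * cos t)); [|ring].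
  apply (wirtinger_curve u l (fun s => r * cos s) (fun s => r * sin s)); trivial.
  - auto_derive; trivial; ring.
  - auto_derive; trivial; ring.
Qed.

Section CircleIntegral.
Variables (u : C -> R) (l : C -> C) (w : R -> R).
Hypothesis Hu : forall z, in_disk z -> wirtinger u z (l z).
Hypothesis Hl : forall z, in_disk z -> continuous_C l z.
Hypothesis Hw : forall t, continuous w t.

Let dr (r t : R) := Re (l (circle r t)) * cos t - Im (l (circle r t)) * sin t.

Lemma continuity_2d_pt_radial (r t : R) :
  Rabs r < 1 -> continuity_2d_pt (fun r t => w t * dr r t) r t.
Proof.
  intros Hr. destruct (Hl _ (circle_in_disk r t Hr)) as [H1 H2].
  apply continuity_2d_pt_mult.
  - now apply continuity_2d_pt_angle.
  - apply continuity_2d_pt_minus; apply continuity_2d_pt_mult.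
    + now apply (continuity_2d_pt_circle (fun z => Re (l z))).
    + apply continuity_2d_pt_angle, continuous_cos.
    + now apply (continuity_2d_pt_circle (fun z => Im (l z))).
    + apply continuity_2d_pt_angle, continuous_sin.
Qed.

Lemma continuous_on_circle (r t : R) :
  Rabs r < 1 -> continuous (fun t => w t * u (circle r t)) t.
Proof.
  intros Hr. apply (continuous_mult w); trivial.
  apply (continuity_2d_pt_slice (fun r t => u (circle r t))).
  apply continuity_2d_pt_circle.
  exact (wirtinger_continuity _ _ _ (Hu _ (circle_in_disk r t Hr))).
Qed.

Lemma ex_RInt_circle (r : R) :
  Rabs r < 1 -> ex_RInt (fun t => w t * u (circle r t)) (- PI) PI.
Proof.
  intros Hr. apply (ex_RInt_continuous (V := R_CompleteNormedModule)).
  intros t _. now apply continuous_on_circle.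
Qed.

Lemma ex_RInt_radial (r : R) :
  Rabs r < 1 -> ex_RInt (fun t => w t * dr r t) (- PI) PI.
Proof.
  intros Hr. apply (ex_RInt_continuous (V := R_CompleteNormedModule)).
  intros t _.
  apply (continuity_2d_pt_slice (fun r t => w t * dr r t)).
  now apply continuity_2d_pt_radial.
Qed.

(** Differentiation under the integral sign; continuity of the gradient is what
    makes the integrand's radial derivative jointly continuous. *)
Lemma is_derive_circle_integral (r : R) :
  Rabs r < 1 ->
  is_derive (fun r => RInt (fun t => w t * u (circle r t)) (- PI) PI) r
    (RInt (fun t => w t * dr r t) (- PI) PI).
Proof.
  intros Hr.
  assert (D : forall s t, Rabs s < 1 ->
    is_derive (fun s => w t * u (circle s t)) s (w t * dr s t)).
  { intros s t Hs. apply is_derive_scal. apply is_derive_circle_radius.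
    now apply Hu, circle_in_disk. }
  apply is_derive_eq with
    (RInt (fun t => Derive (fun s => w t * u (circle s t)) r) (- PI) PI).
  2: { apply RInt_ext. intros t _. now apply is_derive_unique, D. }
  apply (is_derive_RInt_param (fun r t => w t * u (circle r t))).
  - generalize (locally_Rabs_lt r Hr). apply filter_imp.
    intros s Hs t _. eexists. now apply D.
  - intros t _.
    apply continuity_2d_pt_ext_loc with (fun r t => w t * dr r t).
    2: now apply continuity_2d_pt_radial.
    destruct (locally_Rabs_lt r Hr) as [d Hd]. exists d.
    intros s v Hs _. symmetry. apply is_derive_unique, D, Hd, Hs.
  - generalize (locally_Rabs_lt r Hr). apply filter_imp.
    apply ex_RInt_circle.
Qed.
End CircleIntegral.

Lemma derive_0_constant (f : R -> R) (r : R) :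
  0 <= r ->
  (forall s, 0 <= s <= r -> continuous f s) ->
  (forall s, 0 < s < r -> is_derive f s 0) -> f r = f 0.
Proof.
  intros Hr Hc Hd.
  destruct (MVT_gen f 0 r (fun _ => 0)) as [c [_ Hc']].
  - rewrite Rmin_left, Rmax_right by lra. exact Hd.
  - rewrite Rmin_left, Rmax_right by lra. intros s Hs.
    now apply continuity_pt_filterlim, Hc.
  - lra.
Qed.

(** The mean value property, for the real part of a holomorphic g.  The
    derivative of the mean with respect to r is the integral of Re (g' e^{it}), and
    r times this integrand is the angular derivative of Im g, whose integral over
    the full circle vanishes. *)
Lemma holo_circle_mean (g g' : C -> C) (r : R) :
  (forall z, in_disk z -> holo g z (g' z)) ->
  (forall z, in_disk z -> continuous_C g' z) ->
  0 <= r < 1 ->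
  RInt (fun t => Re (g (circle r t))) (- PI) PI = 2 * PI * Re (g (RtoC 0)).
Proof.
  intros Hg Hg' Hr.
  set (J := fun r => RInt (fun t => 1 * Re (g (circle r t))) (- PI) PI).
  assert (HJ : forall s, Rabs s < 1 -> is_derive J s
    (RInt (fun t => 1 * (Re (g' (circle s t)) * cos t
                      - Im (g' (circle s t)) * sin t)) (- PI) PI)).
  { intros s Hs.
    apply (is_derive_circle_integral (fun z => Re (g z)) g' (fun _ => 1)); trivial.
    - intros z Hz. now apply Hg.
    - intros t. apply continuous_const. }
  assert (E : J r = J 0).
  { apply derive_0_constant; [lra| |].
    - intros s Hs. apply (ex_derive_continuous (V := R_NormedModule)).
      eexists. apply HJ. apply Rabs_def1; lra.
    - intros s Hs. assert (Hs' : Rabs s < 1) by (apply Rabs_def1; lra).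
      apply is_derive_eq with (1 := HJ s Hs').
      apply Rmult_eq_reg_l with s; [|lra].
      rewrite Rmult_0_r.
      (* r Re (g' e^{it}) is the derivative of Im g along the circle. *)
      assert (I : is_RInt (fun t => s * (1 * (Re (g' (circle s t)) * cos t
                      - Im (g' (circle s t)) * sin t))) (- PI) PI
          (minus (Im (g (circle s PI))) (Im (g (circle s (- PI)))))).
      { apply (is_RInt_derive (fun t => Im (g (circle s t)))).
        - intros t _. destruct (Hg _ (circle_in_disk s t Hs')) as [_ H].
          apply is_derive_circle_angle in H.
          apply is_derive_eq with (1 := H). unfold Re, Im; simpl. ring.
        - intros t _. apply (continuous_mult (fun _ => s)); [apply continuous_const|].
          apply (continuity_2d_pt_slice (fun s t => 1 * (Re (g' (circle s t)) * cos t
                      - Im (g' (circle s t)) * sin t))).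
          apply (continuity_2d_pt_radial g' (fun _ => 1)); trivial.
          intros. apply continuous_const. }
      etransitivity; [symmetry; apply (RInt_scal (V := R_CompleteNormedModule))|].
      + apply (ex_RInt_radial g' (fun _ => 1)); trivial.
        intros. apply continuous_const.
      + transitivity (minus (Im (g (circle s PI))) (Im (g (circle s (- PI))))).
        * now apply is_RInt_unique.
        * unfold circle. rewrite cos_neg, sin_neg, sin_PI, Ropp_0.
          apply Rminus_diag_eq; reflexivity. }
  transitivity (J r).
  { apply RInt_ext. intros t _. now rewrite Rmult_1_l. }
  rewrite E. unfold J.
  rewrite (RInt_ext _ (fun _ => Re (g (RtoC 0)))).
  - rewrite RInt_const. unfold scal; simpl; unfold mult; simpl. ring.
  - intros t _. rewrite circle_0. apply Rmult_1_l.
Qed.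

(** A harmonic function is carried together with its holomorphic gradient
    g = u_x - i u_y and the derivative g'.  Only continuity of g' is imposed, which
    is what a function of class C^2 provides. *)
Definition harmonic (u : C -> R) (g g' : C -> C) : Prop :=
  forall z, in_disk z -> wirtinger u z (g z) /\ holo g z (g' z) /\ continuous_C g' z.

Lemma zero_in_disk : in_disk (RtoC 0).
Proof. apply in_disk_Re_Im. simpl. lra. Qed.

Lemma continuous_RInt_circle (u : C -> R) (g : C -> C) (w : R -> R) (r : R) :
  (forall z, in_disk z -> wirtinger u z (g z)) ->
  (forall z, in_disk z -> continuous_C g z) -> (forall t, continuous w t) ->
  Rabs r < 1 ->
  continuous (fun r => RInt (fun t => w t * u (circle r t)) (- PI) PI) r.
Proof.
  intros Hu Hg Hw Hr. apply (ex_derive_continuous (V := R_NormedModule)).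
  eexists. now apply (is_derive_circle_integral u g w).
Qed.

Section Means.
Variables (u : C -> R) (g g' : C -> C).
Hypothesis Hu : harmonic u g g'.

Let Hw (z : C) : in_disk z -> wirtinger u z (g z).
Proof. apply Hu. Qed.

Let Hg (z : C) : in_disk z -> holo g z (g' z).
Proof. apply Hu. Qed.

Let Hg' (z : C) : in_disk z -> continuous_C g' z.
Proof. apply Hu. Qed.

Let Hc (z : C) : in_disk z -> continuous_C g z.
Proof. intros Hz. now apply holo_continuous_C with (g' z), Hu. Qed.

(** r times the radial derivative of the mean of u is the integral of Re (z g(z)),
    which vanishes by the mean value property of z g(z). *)
Lemma harmonic_circle_mean (r : R) :
  0 <= r < 1 ->
  RInt (fun t => u (circle r t)) (- PI) PI = 2 * PI * u (RtoC 0).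
Proof.
  intros Hr.
  set (J := fun r => RInt (fun t => 1 * u (circle r t)) (- PI) PI).
  assert (E : J r = J 0).
  { apply derive_0_constant; [lra| |].
    - intros s Hs. apply (continuous_RInt_circle u g (fun _ => 1)); trivial.
      + intros t. apply continuous_const.
      + apply Rabs_def1; lra.
    - intros s Hs. assert (Hs' : Rabs s < 1) by (apply Rabs_def1; lra).
      refine (is_derive_eq _ _ _ _
        (is_derive_circle_integral u g (fun _ => 1) Hw Hc _ s Hs') _).
      { intros t. apply continuous_const. }
      apply Rmult_eq_reg_l with s; [|lra].
      rewrite Rmult_0_r.
      etransitivity; [symmetry; apply (RInt_scal (V := R_CompleteNormedModule))|].
      + apply (ex_RInt_radial g (fun _ => 1)); trivial.
        intros. apply continuous_const.
      + transitivity (RInt (fun t => Re (circle s t * g (circle s t))%C) (- PI) PI).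
        * apply RInt_ext. intros t _. unfold scal; simpl; unfold mult; simpl.
          unfold circle, Re, Im; simpl. ring.
        * rewrite (holo_circle_mean (fun z => z * g z)%C (fun z => 1 * g z + z * g' z)%C).
          -- simpl. ring.
          -- intros z Hz. apply holo_mult; [|now apply Hg].
             apply holo_id.
          -- intros z Hz. apply continuous_C_plus; apply continuous_C_mult; auto.
             ++ apply (holo_continuous_C _ _ _ (holo_const 1 z)).
             ++ apply (holo_continuous_C _ _ _ (holo_id z)).
          -- lra. }
  transitivity (J r).
  { apply RInt_ext. intros t _. now rewrite Rmult_1_l. }
  rewrite E. unfold J.
  rewrite (RInt_ext _ (fun _ => u (RtoC 0))).
  - rewrite RInt_const. unfold scal; simpl; unfold mult; simpl. ring.
  - intros t _. rewrite circle_0. apply Rmult_1_l.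
Qed.

(** Write c(r) for the moment.  Its derivative integrates cos t Re (g e^{it}), while
    integration by parts turns c(r) into r times the integral of
    sin t Im (g e^{it}).  Hence c + r c' is r times the integral of Re g, that is
    2 pi r Re g(0), so r c(r) = pi r^2 Re g(0). *)
Lemma harmonic_circle_moment (r : R) :
  0 < r < 1 ->
  RInt (fun t => cos t * u (circle r t)) (- PI) PI = PI * r * Re (g (RtoC 0)).
Proof.
  intros Hr.
  set (c := fun r => RInt (fun t => cos t * u (circle r t)) (- PI) PI).
  set (dr := fun r t => Re (g (circle r t)) * cos t - Im (g (circle r t)) * sin t).
  assert (Dc : forall s, Rabs s < 1 ->
    is_derive c s (RInt (fun t => cos t * dr s t) (- PI) PI)).
  { intros s Hs. apply (is_derive_circle_integral u g cos); trivial.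
    apply continuous_cos. }
  set (e := fun r => r * c r - PI * r ^ 2 * Re (g (RtoC 0))).
  assert (De : forall s, Rabs s < 1 -> is_derive e s
    (c s + s * RInt (fun t => cos t * dr s t) (- PI) PI - 2 * PI * s * Re (g (RtoC 0)))).
  { intros s Hs. unfold e. apply (is_derive_minus (V := R_NormedModule)).
    - refine (is_derive_eq _ _ _ _ (is_derive_mult (fun s => s) c s 1 _
        (is_derive_id s) (Dc s Hs) Rmult_comm) _).
      unfold plus, mult; simpl. ring.
    - auto_derive; trivial. ring. }
  assert (E : e r = e 0).
  { apply derive_0_constant; [lra| |].
    - intros s Hs. apply (ex_derive_continuous (V := R_NormedModule)).
      eexists. apply De, Rabs_def1; lra.
    - intros s Hs. assert (Hs' : Rabs s < 1) by (apply Rabs_def1; lra).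
      refine (is_derive_eq _ _ _ _ (De s Hs') _).
      assert (M := holo_circle_mean g g' s Hg Hg' (conj (Rlt_le _ _ (proj1 Hs))
        (Rlt_trans _ _ _ (proj2 Hs) (proj2 Hr)))).
      assert (I : is_RInt (fun t => cos t * u (circle s t) + s * (cos t * dr s t)
          + (- s) * Re (g (circle s t))) (- PI) PI
          (plus (plus (c s) (scal s (RInt (fun t => cos t * dr s t) (- PI) PI)))
             (scal (- s) (2 * PI * Re (g (RtoC 0)))))).
      { apply (is_RInt_plus (V := R_NormedModule)).
        apply (is_RInt_plus (V := R_NormedModule)).
        - apply (RInt_correct (V := R_CompleteNormedModule)).
          apply (ex_RInt_circle u g); trivial. apply continuous_cos.
        - apply (is_RInt_scal (V := R_NormedModule)).
          apply (RInt_correct (V := R_CompleteNormedModule)).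
          apply ex_RInt_radial; trivial. apply continuous_cos.
        - apply (is_RInt_scal (V := R_NormedModule)). rewrite <- M.
          apply (RInt_correct (V := R_CompleteNormedModule)).
          apply (ex_RInt_continuous (V := R_CompleteNormedModule)). intros t _.
          apply (continuity_2d_pt_slice (fun s t => Re (g (circle s t)))).
          apply (continuity_2d_pt_circle (fun z => Re (g z))).
          apply (Hc _ (circle_in_disk s t Hs')). }
      apply (is_RInt_unique (V := R_CompleteNormedModule)) in I.
      transitivity (RInt (fun t => cos t * u (circle s t) + s * (cos t * dr s t)
          + (- s) * Re (g (circle s t))) (- PI) PI).
      { rewrite I. unfold plus, scal; simpl; unfold mult; simpl. ring. }
      apply is_RInt_unique.
      replace 0 with (minus (sin PI * u (circle s PI)) (sin (- PI) * u (circle s (- PI)))).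
      2: { rewrite sin_neg, sin_PI. unfold minus, plus, opp; simpl. ring. }
      apply (is_RInt_derive (fun t => sin t * u (circle s t))).
      + intros t _.
        assert (Dt := is_derive_circle_angle u _ s t (Hw _ (circle_in_disk s t Hs'))).
        refine (is_derive_eq _ _ _ _ (is_derive_mult sin _ t _ _
          (is_derive_sin t) Dt Rmult_comm) _).
        unfold plus, mult, dr; simpl.
        rewrite <- (Rmult_1_r (- s * Re (g (circle s t)))), <- (sin2_cos2 t).
        unfold Rsqr. ring.
      + intros t _.
        apply (continuous_plus (V := R_NormedModule)).
        apply (continuous_plus (V := R_NormedModule)).
        * apply (continuous_on_circle u g); trivial. apply continuous_cos.
        * apply (continuous_mult (fun _ => s)); [apply continuous_const|].
          apply (continuity_2d_pt_slice (fun s t => cos t * dr s t)).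
          apply (continuity_2d_pt_radial g cos); trivial. apply continuous_cos.
        * apply (continuous_mult (fun _ => - s)); [apply continuous_const|].
          apply (continuity_2d_pt_slice (fun s t => Re (g (circle s t)))).
          apply (continuity_2d_pt_circle (fun z => Re (g z))).
          apply (Hc _ (circle_in_disk s t Hs')). }
  unfold e in E. change (c r = PI * r * Re (g (RtoC 0))).
  apply Rmult_eq_reg_l with r; lra.
Qed.
End Means.

(** * The gradient of a bounded harmonic function at the center *)

Lemma is_RInt_cos_minus (c a b : R) :
  is_RInt (fun t => cos t - c) a b (sin b - sin a - c * (b - a)).
Proof.
  replace (sin b - sin a - c * (b - a)) with (minus (sin b - c * b) (sin a - c * a))
    by (unfold minus, plus, opp; simpl; ring).
  apply (is_RInt_derive (fun t => sin t - c * t)).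
  - intros t _. auto_derive; trivial. ring.
  - intros t _. apply (continuous_minus (V := R_NormedModule)).
    apply continuous_cos. apply continuous_const.
Qed.

Lemma cos_le_cos_Rabs (s t : R) : Rabs s <= Rabs t <= PI -> cos t <= cos s.
Proof.
  intros [H1 H2].
  assert (E : forall x, cos x = cos (Rabs x)).
  { intros x. unfold Rabs. destruct (Rcase_abs x); trivial. now rewrite cos_neg. }
  rewrite (E s), (E t). pose proof (Rabs_pos s). apply cos_decr_1; lra.
Qed.

(** With al = pi (1+m)/2, the function V equal to 1 for |t| <= al and to -1
    elsewhere has mean m and moment 4 sin al = 4 cos (pi m / 2).  It is optimal since
    (cos t - cos al) U <= |cos t - cos al| = (cos t - cos al) V, and subtracting a
    multiple of the fixed mean from the moment does not change the comparison. *)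
Lemma bathtub (U : R -> R) (m : R) :
  (forall t, continuous U t) -> (forall t, -1 <= U t <= 1) ->
  RInt U (- PI) PI = 2 * PI * m ->
  RInt (fun t => cos t * U t) (- PI) PI <= 4 * cos (PI / 2 * m).
Proof.
  intros Hc Hb Hm. pose proof PI_RGT_0 as Hpi.
  assert (IU : ex_RInt U (- PI) PI).
  { apply (ex_RInt_continuous (V := R_CompleteNormedModule)). auto. }
  assert (IC : ex_RInt (fun t => cos t * U t) (- PI) PI).
  { apply (ex_RInt_continuous (V := R_CompleteNormedModule)). intros t _.
    apply (continuous_mult cos); auto. apply continuous_cos. }
  assert (Hm1 : -1 <= m <= 1).
  { assert (2 * PI * m <= 2 * PI * 1).
    { rewrite <- Hm. replace (2 * PI * 1) with (RInt (fun _ => 1) (- PI) PI).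
      2: { rewrite RInt_const. unfold scal; simpl; unfold mult; simpl. ring. }
      apply RInt_le; [lra|trivial|apply ex_RInt_const|]. intros t _. apply Hb. }
    assert (2 * PI * (-1) <= 2 * PI * m).
    { rewrite <- Hm. replace (2 * PI * (-1)) with (RInt (fun _ => -1) (- PI) PI).
      2: { rewrite RInt_const. unfold scal; simpl; unfold mult; simpl. ring. }
      apply RInt_le; [lra|apply ex_RInt_const|trivial|]. intros t _. apply Hb. }
    split; apply Rmult_le_reg_l with (2 * PI); lra. }
  set (al := PI / 2 * (1 + m)).
  assert (Hal : 0 <= al <= PI) by (unfold al; split; nra).
  set (c := cos al).
  assert (I1 : is_RInt (fun t => Rabs (cos t - c)) (- PI) (- al)
                 (- (sin (- al) - sin (- PI) - c * (- al - - PI)))).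
  { apply is_RInt_ext with (fun t => - (cos t - c)).
    2: exact (is_RInt_opp (V := R_NormedModule) _ _ _ _ (is_RInt_cos_minus c (- PI) (- al))).
    rewrite Rmin_left, Rmax_right by lra. intros t Ht.
    rewrite Rabs_left1; trivial. apply Rle_minus, cos_le_cos_Rabs.
    rewrite Rabs_right, Rabs_left by lra. lra. }
  assert (I2 : is_RInt (fun t => Rabs (cos t - c)) (- al) al
                 (sin al - sin (- al) - c * (al - - al))).
  { apply is_RInt_ext with (2 := is_RInt_cos_minus c (- al) al).
    rewrite Rmin_left, Rmax_right by lra. intros t Ht.
    rewrite Rabs_right; trivial. apply Rge_minus, Rle_ge, cos_le_cos_Rabs.
    rewrite (Rabs_right al) by lra. split; [|lra]. apply Rabs_le. lra. }
  assert (I3 : is_RInt (fun t => Rabs (cos t - c)) al PI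
                 (- (sin PI - sin al - c * (PI - al)))).
  { apply is_RInt_ext with (fun t => - (cos t - c)).
    2: exact (is_RInt_opp (V := R_NormedModule) _ _ _ _ (is_RInt_cos_minus c al PI)).
    rewrite Rmin_left, Rmax_right by lra. intros t Ht.
    rewrite Rabs_left1; trivial. apply Rle_minus, cos_le_cos_Rabs.
    rewrite !Rabs_right by lra. lra. }
  assert (IA := is_RInt_Chasles _ _ _ _ _ _ (is_RInt_Chasles _ _ _ _ _ _ I1 I2) I3).
  assert (ID := is_RInt_minus _ _ _ _ _ _ (RInt_correct _ _ _ IC)
                  (is_RInt_scal _ _ _ c _ (RInt_correct _ _ _ IU))).
  assert (Hpp : - PI <= PI) by lra.
  assert (L := is_RInt_le _ _ _ _ _ _ Hpp ID IA).
  rewrite Hm in L.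
  unfold minus, plus, opp, scal in L; simpl in L; unfold mult in L; simpl in L.
  rewrite !sin_neg, sin_PI in L.
  replace (cos (PI / 2 * m)) with (sin al).
  2: { rewrite <- (sin_shift (PI / 2 * m)), <- sin_PI_x. f_equal. unfold al. field. }
  assert (EE : c * (2 * PI * m) = c * (4 * al - 2 * PI)) by (unfold al; field).
  enough (forall t, - PI < t < PI ->
    cos t * U t + - (c * U t) <= Rabs (cos t - c)) by (specialize (L H); lra).
  intros t _. replace (cos t * U t + - (c * U t)) with ((cos t - c) * U t) by ring.
  apply Rle_trans with (1 := Rle_abs _). rewrite Rabs_mult.
  rewrite <- (Rmult_1_r (Rabs (cos t - c))) at 2.
  apply Rmult_le_compat_l; [apply Rabs_pos|]. apply Rabs_le, Hb.
Qed.

(** The bathtub bound on the circle of radius r bounds pi r u_x(0); the factor r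
    disappears as r tends to 1. *)
Lemma Re_gradient_center (u : C -> R) (g g' : C -> C) :
  harmonic u g g' -> (forall z, in_disk z -> -1 <= u z <= 1) ->
  PI * Re (g (RtoC 0)) <= 4 * cos (PI / 2 * u (RtoC 0)).
Proof.
  intros Hu Hb. set (A := PI * _). set (B := 4 * _).
  assert (HB : 0 <= B).
  { unfold B. pose proof PI_RGT_0. destruct (Hb _ zero_in_disk).
    assert (0 <= cos (PI / 2 * u (RtoC 0))) by (apply cos_ge_0; nra). lra. }
  assert (H : forall r, 0 < r < 1 -> r * A <= B).
  { intros r Hr. assert (Hr' : Rabs r < 1) by (apply Rabs_def1; lra).
    replace (r * A) with (PI * r * Re (g (RtoC 0))) by (unfold A; ring).
    rewrite <- (harmonic_circle_moment u g g' Hu r Hr).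
    apply (bathtub (fun t => u (circle r t))).
    - intros t. apply (continuity_2d_pt_slice (fun r t => u (circle r t))).
      apply continuity_2d_pt_circle.
      exact (wirtinger_continuity _ _ _ (proj1 (Hu _ (circle_in_disk r t Hr')))).
    - intros t. now apply Hb, circle_in_disk.
    - apply (harmonic_circle_mean u g g' Hu). lra. }
  destruct (Rle_lt_dec A B) as [|Hlt]; trivial.
  assert (Hr : 0 < (A + B) / (2 * A) < 1).
  { split; [apply Rdiv_lt_0_compat|apply Rlt_div_l]; lra. }
  specialize (H _ Hr). replace ((A + B) / (2 * A) * A) with ((A + B) / 2) in H by (field; lra).
  lra.
Qed.

(** * Conformal invariance *)
Lemma harmonic_comp (u : C -> R) (g g' phi phi' phi'' : C -> C) :
  harmonic u g g' ->
  (forall z, in_disk z -> in_disk (phi z) /\ holo phi z (phi' z) /\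
     holo phi' z (phi'' z) /\ continuous_C phi'' z) ->
  harmonic (fun z => u (phi z)) (fun z => g (phi z) * phi' z)%C
    (fun z => g' (phi z) * phi' z * phi' z + g (phi z) * phi'' z)%C.
Proof.
  intros Hu Hphi z Hz.
  destruct (Hphi z Hz) as (D & H1 & H2 & H3). destruct (Hu _ D) as (U1 & U2 & U3).
  assert (C1 := holo_continuous_C _ _ _ H1). assert (C2 := holo_continuous_C _ _ _ H2).
  assert (C3 := holo_continuous_C _ _ _ U2).
  refine (conj _ (conj _ _)).
  - now apply wirtinger_comp.
  - apply (holo_mult _ _ _ _ _ (holo_comp _ _ _ _ _ U2 H1) H2).
  - apply (continuous_C_plus (fun z => g' (phi z) * phi' z * phi' z)%C (fun z => g (phi z) * phi'' z)%C).
    + apply (continuous_C_mult (fun z => g' (phi z) * phi' z)%C); trivial.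
      apply (continuous_C_mult (fun z => g' (phi z))); trivial. now apply continuous_C_comp.
    + apply (continuous_C_mult (fun z => g (phi z))); trivial. now apply continuous_C_comp.
Qed.

Lemma Cmod_sqr (z : C) : Cmod z ^ 2 = Re z ^ 2 + Im z ^ 2.
Proof. unfold Cmod. rewrite pow2_sqrt. reflexivity. unfold Re, Im. nra. Qed.

(** |1 + conj(a) w|^2 - |a + w|^2 = (1 - |a|^2)(1 - |w|^2). *)
Lemma Cmod_moebius_lt (a w : C) :
  in_disk a -> in_disk w ->
  Cmod (a + w) < Cmod (1 + Cconj a * w).
Proof.
  rewrite !in_disk_Re_Im. intros Ha Hw.
  apply Rsqr_incrst_0; auto using Cmod_ge_0.
  rewrite !Rsqr_pow2, !Cmod_sqr.
  destruct a as [p q], w as [x y]; unfold Re, Im in *; simpl in *.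
  assert (0 < (1 - (p * p + q * q)) * (1 - (x * x + y * y))) by (apply Rmult_lt_0_compat; lra).
  nra.
Qed.

(** The automorphism (a + e z) / (1 + conj(a) e z), with |e| = 1, sends 0 to a.  The
    unimodular factor e is kept so that its derivative at 0, e (1 - |a|^2), can be
    given any argument. *)
Lemma moebius_automorphism (a e z : C) :
  in_disk a -> Cmod e = 1 ->
  let b := (Cconj a * e)%C in
  let d := fun z => (/ (1 + b * z))%C in
  let d' := fun z => (- (b * (d z * d z)))%C in
  in_disk z ->
  in_disk ((a + e * z) * d z) /\
  holo (fun z => (a + e * z) * d z)%C z ((e - a * b) * (d z * d z))%C /\
  holo (fun z => (e - a * b) * (d z * d z))%C z
    (0 * (d z * d z) + (e - a * b) * (d' z * d z + d z * d' z))%C /\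
  continuous_C (fun z => 0 * (d z * d z) + (e - a * b) * (d' z * d z + d z * d' z))%C z.
Proof.
  intros Ha He b d d' Hz.
  assert (Hez : in_disk (e * z)).
  { unfold in_disk. now rewrite Cmod_mult, He, Rmult_1_l. }
  assert (Hlt := Cmod_moebius_lt a (e * z) Ha Hez).
  replace (1 + Cconj a * (e * z))%C with (1 + b * z)%C in Hlt by (unfold b; ring).
  assert (Hn : 0 < Cmod (1 + b * z)).
  { apply Rle_lt_trans with (2 := Hlt), Cmod_ge_0. }
  assert (Hn0 : (1 + b * z)%C <> RtoC 0) by now apply Cmod_gt_0.
  assert (Hd : holo d z (d' z)) by now apply holo_inv, holo_affine.
  assert (Hdd : holo (fun z => d z * d z)%C z (d' z * d z + d z * d' z)%C)
    by now apply holo_mult.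
  assert (Cd := holo_continuous_C _ _ _ Hd). assert (Cdd := holo_continuous_C _ _ _ Hdd).
  assert (Cd' : continuous_C d' z).
  { apply (continuous_C_mult (fun _ => - b)%C (fun z => d z * d z)%C) in Cdd.
    2: exact (holo_continuous_C _ _ _ (holo_const (- b) z)).
    destruct Cdd as [H1 H2]. split.
    - apply continuity_2d_pt_ext with (2 := H1). intros x y. unfold d'. f_equal. ring.
    - apply continuity_2d_pt_ext with (2 := H2). intros x y. unfold d'. f_equal. ring. }
  split; [|split; [|split]].
  - unfold in_disk, d. rewrite Cmod_mult, Cmod_inv by trivial.
    apply Rmult_lt_reg_r with (1 := Hn). rewrite Rmult_assoc, Rinv_l; lra.
  - refine (holo_eq _ _ _ _ (holo_mult _ _ _ _ _ (holo_affine a e z) Hd) _).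
    unfold d', d. field. trivial.
  - exact (holo_mult _ _ _ _ _ (holo_const (e - a * b) z) Hdd).
  - refine (continuous_C_plus (fun z => 0 * (d z * d z))%C
      (fun z => (e - a * b) * (d' z * d z + d z * d' z))%C z _ _).
    + refine (continuous_C_mult (fun _ => 0%C) _ z _ Cdd).
      exact (holo_continuous_C _ _ _ (holo_const 0 z)).
    + refine (continuous_C_mult (fun _ => e - a * b)%C (fun z => d' z * d z + d z * d' z)%C z _ _).
      exact (holo_continuous_C _ _ _ (holo_const (e - a * b) z)).
      refine (continuous_C_plus (fun z => d' z * d z)%C (fun z => d z * d' z)%C z _ _);
        now apply continuous_C_mult.
Qed.

(** The center bound for u composed with the automorphism sending 0 to a, whose
    gradient at 0 is g(a) e (1 - |a|^2). *)
Theorem harmonic_gradient_bound (u : C -> R) (g g' : C -> C) (a : C) :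
  harmonic u g g' -> (forall z, in_disk z -> -1 <= u z <= 1) -> in_disk a ->
  PI * (Cmod (g a) * (1 - Cmod a ^ 2)) <= 4 * cos (PI / 2 * u a).
Proof.
  intros Hu Hb Ha.
  destruct (Req_dec (Cmod (g a)) 0) as [E|E].
  - rewrite E, Rmult_0_l, Rmult_0_r. pose proof PI_RGT_0. destruct (Hb _ Ha).
    assert (0 <= cos (PI / 2 * u a)) by (apply cos_ge_0; nra). lra.
  - (* This argument of e makes the real part of g(a) e equal to |g(a)|. *)
    set (e := (Cconj (g a) * / Cmod (g a))%C).
    assert (E' : RtoC (Cmod (g a)) <> RtoC 0) by (intros H; apply E; now injection H).
    assert (He : Cmod e = 1).
    { unfold e. rewrite Cmod_mult, Cmod_inv, Cmod_conj, Cmod_R by trivial.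
      rewrite Rabs_right by (apply Rle_ge, Cmod_ge_0). now apply Rinv_r. }
    assert (K := Re_gradient_center _ _ _
      (harmonic_comp _ _ _ _ _ _ Hu (fun z Hz => moebius_automorphism a e z Ha He Hz))).
    cbv beta zeta in K.
    replace ((a + e * 0) * / (1 + Cconj a * e * 0))%C with a in K
      by (field; intros H; injection H; lra).
    replace (Re _) with (Cmod (g a) * (1 - Cmod a ^ 2)) in K.
    + apply K. intros z Hz. now apply Hb, (moebius_automorphism a e z Ha He).
    + transitivity (Re (RtoC (Cmod (g a) * (1 - Cmod a ^ 2)))); trivial. f_equal.
      assert (Eg : (g a * Cconj (g a) = Cmod (g a) * Cmod (g a))%C).
      { rewrite <- RtoC_mult, <- (Rmult_1_r (Cmod (g a) * Cmod (g a))).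
        replace (_ * 1) with (Cmod (g a) ^ 2) by ring. rewrite Cmod_sqr. C_ring. }
      assert (Ea : (a * Cconj a = RtoC (Cmod a ^ 2))%C).
      { rewrite Cmod_sqr. C_ring. }
      rewrite RtoC_mult, RtoC_minus, <- Ea. unfold e.
      transitivity ((g a * Cconj (g a)) * / Cmod (g a) * (1 - a * Cconj a))%C.
      2: { field. intros H; injection H; lra. }
      rewrite Eg. field. trivial.
Qed.

(** * The harmonic Schwarz lemma *)

(** Put T = tan (pi (1 + v) / 4).  Since (1 + T^2) cos (pi v / 2) = 2 T, the
    hypothesis becomes (1 - t^2) T' <= 2 T, so T (1 - t) / (1 + t) is nonincreasing and
    T(r) <= (1 + r) / (1 - r) = tan (pi/4 + atan r). *)
Lemma radial_comparison (v dv : R -> R) (r : R) :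
  0 <= r < 1 -> v 0 = 0 ->
  (forall t, 0 <= t <= r -> is_derive v t (dv t)) ->
  (forall t, 0 <= t <= r -> -1 < v t < 1) ->
  (forall t, 0 <= t <= r -> PI * (dv t * (1 - t ^ 2)) <= 4 * cos (PI / 2 * v t)) ->
  v r <= 4 / PI * atan r.
Proof.
  intros Hr H0 Hd Hb Hv. pose proof PI_RGT_0 as Hpi.
  set (be := fun t => PI / 4 * (1 + v t)).
  assert (Hbe : forall t, 0 <= t <= r -> 0 < be t < PI / 2).
  { intros t Ht. specialize (Hb t Ht). unfold be. split; nra. }
  assert (Hcos : forall t, 0 <= t <= r -> 0 < cos (be t)).
  { intros t Ht. destruct (Hbe t Ht). apply cos_gt_0; lra. }
  set (W := fun t => tan (be t) * ((1 - t) / (1 + t))).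
  set (dW := fun t => (tan (be t) ^ 2 + 1) * (PI / 4 * dv t) * ((1 - t) / (1 + t))
                 - tan (be t) * (2 / (1 + t) ^ 2)).
  assert (DW : forall t, 0 <= t <= r -> is_derive W t (dW t)).
  { intros t Ht. unfold W.
    assert (D1 : is_derive (fun t => tan (be t)) t ((tan (be t) ^ 2 + 1) * (PI / 4 * dv t))).
    { refine (is_derive_eq _ _ _ _ (is_derive_comp tan be t _ _
        (is_derive_tan (be t) _) _) _).
      - specialize (Hcos t Ht). lra.
      - unfold be. apply is_derive_scal.
        refine (is_derive_plus (V := R_NormedModule) (fun _ => 1) v t 0 _ _ (Hd t Ht)).
        apply (is_derive_const (V := R_NormedModule)).
      - unfold scal, plus; simpl; unfold mult; simpl. ring. }
    assert (D2 : is_derive (fun t => (1 - t) / (1 + t)) t (- (2 / (1 + t) ^ 2))).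
    { auto_derive; [lra|field; lra]. }
    refine (is_derive_eq _ _ _ _ (is_derive_mult _ _ _ _ _ D1 D2 Rmult_comm) _).
    unfold plus, mult, dW; simpl. ring. }
  assert (dWle : forall t, 0 <= t <= r -> dW t <= 0).
  { intros t Ht. specialize (Hcos t Ht). specialize (Hv t Ht).
    assert (E : (tan (be t) ^ 2 + 1) * cos (PI / 2 * v t) = 2 * tan (be t)).
    { replace (cos (PI / 2 * v t)) with (2 * sin (be t) * cos (be t)).
      - unfold tan. rewrite <- (Rmult_1_r (2 * _)).
        replace ((sin (be t) / cos (be t)) ^ 2 + 1) with (/ cos (be t) ^ 2).
        2: { apply Rmult_eq_reg_r with (cos (be t) ^ 2). 2: apply pow_nonzero; lra.
             pose proof (sin2_cos2 (be t)). unfold Rsqr in *.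
             rewrite Rinv_l by (apply pow_nonzero; lra).
             symmetry. rewrite <- H at 2. field. lra. }
        field. lra.
      - rewrite <- sin_2a, <- sin_shift, <- sin_PI_x. f_equal. unfold be. field. }
    assert (K : (tan (be t) ^ 2 + 1) * (PI / 4 * dv t) * (1 - t ^ 2) <= 2 * tan (be t)).
    { rewrite <- E. rewrite Rmult_assoc. apply Rmult_le_compat_l; [nra|lra]. }
    replace (dW t) with
      (((tan (be t) ^ 2 + 1) * (PI / 4 * dv t) * (1 - t ^ 2) - 2 * tan (be t)) * / (1 + t) ^ 2)
      by (unfold dW; field; lra).
    assert (0 < / (1 + t) ^ 2) by (apply Rinv_0_lt_compat, pow_lt; lra). nra. }
  assert (HW : W r <= W 0).
  { destruct (MVT_gen W 0 r dW) as [c [Hc E]].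
    - rewrite Rmin_left, Rmax_right by lra. intros t Ht. apply DW. lra.
    - rewrite Rmin_left, Rmax_right by lra. intros t Ht.
      apply continuity_pt_filterlim.
      apply (ex_derive_continuous (V := R_NormedModule)). eexists. now apply DW.
    - rewrite Rmin_left, Rmax_right in Hc by lra.
      specialize (dWle c Hc). nra. }
  assert (W0 : W 0 = 1).
  { unfold W, be. rewrite H0.
    replace (PI / 4 * (1 + 0)) with (PI / 4) by ring. rewrite tan_PI4. field. }
  assert (Hat : 0 <= atan r < PI / 4).
  { split.
    - rewrite <- atan_0. destruct (Req_dec r 0) as [->|]; [lra|].
      apply Rlt_le, atan_increasing. lra.
    - rewrite <- atan_1. apply atan_increasing. lra. }
  apply Rnot_lt_le. intros Hlt.
  assert (Hb2 : PI / 4 + atan r < be r).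
  { unfold be. apply Rmult_lt_compat_l with (r := PI / 4) in Hlt; [|lra].
    replace (PI / 4 * (4 / PI * atan r)) with (atan r) in Hlt by (field; lra). lra. }
  assert (Hbr : 0 <= r <= r) by lra.
  apply tan_increasing in Hb2; [|lra|apply Hbe; lra].
  rewrite tan_plus, tan_PI4, tan_atan in Hb2.
  - unfold W in *. rewrite W0 in HW.
    assert (tan (be r) <= (1 + r) / (1 - r)).
    { apply Rmult_le_reg_r with ((1 - r) / (1 + r)).
      - apply Rdiv_lt_0_compat; lra.
      - replace ((1 + r) / (1 - r) * ((1 - r) / (1 + r))) with 1 by (field; lra).
        exact HW. }
    rewrite Rmult_1_l in Hb2. lra.
  - apply Rgt_not_eq, cos_gt_0; lra.
  - apply Rgt_not_eq, cos_gt_0; lra.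
  - apply Rgt_not_eq, cos_gt_0; lra.
  - rewrite tan_PI4, tan_atan. lra.
Qed.

(** Integrates the gradient bound along the radius through z, for u and for - u. *)
Theorem harmonic_schwarz (u : C -> R) (g g' : C -> C) (z : C) :
  harmonic u g g' -> (forall z, in_disk z -> -1 < u z < 1) -> u (RtoC 0) = 0 ->
  in_disk z -> Rabs (u z) <= 4 / PI * atan (Cmod z).
Proof.
  intros Hu Hb H0 Hz. pose proof PI_RGT_0 as Hpi.
  destruct (Req_dec (Cmod z) 0) as [E|E].
  { rewrite E, atan_0. apply Cmod_eq_0 in E. rewrite E, H0, Rabs_R0. lra. }
  pose proof (Cmod_ge_0 z) as Hz0. set (r := Cmod z) in *.
  set (c := Re z / r). set (s := Im z / r).
  assert (Hcs : c ^ 2 + s ^ 2 = 1).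
  { pose proof (Cmod_sqr z) as H. fold r in H.
    apply Rmult_eq_reg_r with (r ^ 2); [|now apply pow_nonzero].
    unfold c, s. rewrite H at 2. field. trivial. }
  assert (Hray : forall t, Cmod (t * c, t * s) = Rabs t).
  { intros t. unfold Cmod; simpl fst; simpl snd.
    replace ((t * c) ^ 2 + (t * s) ^ 2) with (t ^ 2 * (c ^ 2 + s ^ 2)) by ring.
    rewrite Hcs, Rmult_1_r. rewrite <- Rsqr_pow2. apply sqrt_Rsqr_abs. }
  assert (Hin : forall t, 0 <= t <= r -> in_disk (t * c, t * s)).
  { intros t Ht. unfold in_disk in *. rewrite Hray, Rabs_right by lra. fold r in Hz. lra. }
  set (v := fun t => u (t * c, t * s)).
  set (dv := fun t => Re (g (t * c, t * s)) * c - Im (g (t * c, t * s)) * s).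
  assert (Dv : forall t, 0 <= t <= r -> is_derive v t (dv t)).
  { intros t Ht.
    apply (wirtinger_curve u _ (fun t => t * c) (fun t => t * s)).
    - apply Hu. now apply Hin.
    - auto_derive; trivial; ring.
    - auto_derive; trivial; ring. }
  assert (Hdv : forall t, 0 <= t <= r ->
    PI * (Rabs (dv t) * (1 - t ^ 2)) <= 4 * cos (PI / 2 * v t)).
  { intros t Ht. assert (Ht' := Hin t Ht).
    apply Rle_trans with (2 := harmonic_gradient_bound u g g' _ Hu
      (fun z Hz => conj (Rlt_le _ _ (proj1 (Hb z Hz))) (Rlt_le _ _ (proj2 (Hb z Hz)))) Ht').
    apply Rmult_le_compat_l; [lra|].
    unfold in_disk in Ht'. rewrite Hray in Ht' |- *. rewrite (Rabs_right t) in Ht' |- * by lra.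
    apply Rmult_le_compat_r; [nra|].
    rewrite <- sqrt_Rsqr_abs. apply sqrt_le_1_alt. unfold Rsqr, dv.
    unfold Re, Im. set (p := fst _). set (q := snd _).
    replace (p ^ 2 + q ^ 2) with ((p ^ 2 + q ^ 2) * (c ^ 2 + s ^ 2))
      by (rewrite Hcs; ring).
    assert (0 <= (p * s + q * c) ^ 2) by apply pow2_ge_0. lra. }
  assert (Hr : 0 <= r < 1) by (split; trivial).
  assert (V0 : v 0 = 0) by (unfold v; rewrite !Rmult_0_l; exact H0).
  assert (Ez : v r = u z).
  { unfold v, c, s. f_equal. apply C_eq; simpl; field; trivial. }
  rewrite <- Ez. apply Rabs_le. split.
  - enough (- v r <= 4 / PI * atan r) by lra.
    apply (radial_comparison (fun t => - v t) (fun t => - dv t)); trivial.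
    + rewrite V0. ring.
    + intros t Ht. apply (is_derive_opp (V := R_NormedModule)). now apply Dv.
    + intros t Ht. specialize (Hb _ (Hin t Ht)). unfold v. lra.
    + intros t Ht. replace (PI / 2 * - v t) with (- (PI / 2 * v t)) by ring.
      rewrite cos_neg. apply Rle_trans with (2 := Hdv t Ht).
      apply Rmult_le_compat_l; [lra|]. apply Rmult_le_compat_r; [nra|].
      rewrite <- Rabs_Ropp. apply Rle_abs.
  - apply (radial_comparison v dv); trivial.
    + intros t Ht. apply (Hb _ (Hin t Ht)).
    + intros t Ht. apply Rle_trans with (2 := Hdv t Ht).
      apply Rmult_le_compat_l; [lra|]. apply Rmult_le_compat_r; [nra|].
      apply Rle_abs.
Qed.

(** * Primitives of unimodal densities *)

Lemma decreasing_left_limit (rho : R -> R) :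
  (forall t, 0 < t < 1 -> 0 < rho t) -> decreasing_on rho 0 1 ->
  exists L, forall eps, 0 < eps ->
    exists d, 0 < d /\ forall t, 1 - d < t < 1 -> Rabs (rho t - L) < eps.
Proof.
  intros Hpos Hdec.
  set (E := fun y => exists t, 0 < t < 1 /\ y = - rho t).
  destruct (completeness E) as [m [Hub Hlub]].
  - exists 0. intros y [t [Ht ->]]. specialize (Hpos t Ht). lra.
  - exists (- rho (1 / 2)), (1 / 2). split; [lra|reflexivity].
  - exists (- m). intros eps Heps.
    assert (H : exists s, 0 < s < 1 /\ m - eps < - rho s).
    { destruct (Classical_Prop.classic (exists s, 0 < s < 1 /\ m - eps < - rho s))
        as [H|H]; trivial.
      exfalso. enough (m <= m - eps) by lra. apply Hlub. intros y [t [Ht ->]].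
      apply Rnot_lt_le. intros Hlt. apply H. now exists t. }
    destruct H as [s [Hs Hlt]]. exists (1 - s). split; [lra|]. intros t Ht.
    assert (rho t <= rho s) by (apply Hdec; lra).
    assert (- rho t <= m) by (apply Hub; exists t; split; [lra|reflexivity]).
    apply Rabs_def1; lra.
Qed.

Definition extend_ends (rho : R -> R) (L1 L2 t : R) : R :=
  if Rle_dec t (-1) then L1 else if Rlt_dec t 1 then rho t else L2.

(** The values of rho at the end points are arbitrary; replacing them by the
    one-sided limits gives a function continuous on the whole line, to which the
    fundamental theorem of calculus applies at -1 and 1 as well. *)
Lemma unimodal_extension (rho : R -> R) :
  unimodal_density rho ->
  exists sigma, (forall t, continuous sigma t) /\
    (forall t, -1 < t < 1 -> sigma t = rho t).
Proof.
  intros [[Hpos Hsm] [Hinc Hdec]].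
  destruct (decreasing_left_limit rho) as [L2 H2]; trivial.
  { intros t Ht. apply Hpos. lra. }
  destruct (decreasing_left_limit (fun t => rho (- t))) as [L1 H1].
  { intros t Ht. apply Hpos. lra. }
  { intros s t Hs Hst Ht. apply Hinc; lra. }
  exists (extend_ends rho L1 L2). split.
  2: { intros t Ht. unfold extend_ends.
       destruct (Rle_dec t (-1)); [lra|]. destruct (Rlt_dec t 1); lra. }
  intros t. apply continuity_pt_filterlim.
  destruct (Rlt_le_dec t (-1)) as [Ht|Ht]; [|destruct (Rle_lt_or_eq_dec _ _ Ht) as [Ht'|<-]].
  - apply continuity_pt_ext_loc with (fun _ => L1).
    2: apply continuity_pt_const; now intros ? ?.
    apply (locally_open (fun t => t < -1)); trivial. apply open_lt.
    intros x Hx. unfold extend_ends. destruct (Rle_dec x (-1)); lra.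
  - destruct (Rlt_le_dec t 1) as [Ht2|Ht2]; [|destruct (Rle_lt_or_eq_dec _ _ Ht2) as [Ht3|<-]].
    + apply continuity_pt_ext_loc with rho.
      * apply (locally_open (fun t => -1 < t /\ t < 1)); [| |now split].
        { apply open_and. apply open_gt. apply open_lt. }
        intros x Hx. unfold extend_ends.
        destruct (Rle_dec x (-1)); [lra|]. destruct (Rlt_dec x 1); lra.
      * apply continuity_pt_filterlim.
        apply (ex_derive_continuous (V := R_NormedModule)).
        exact (Hsm 1%nat t (conj Ht' Ht2)).
    + apply continuity_pt_ext_loc with (fun _ => L2).
      2: apply continuity_pt_const; now intros ? ?.
      apply (locally_open (fun t => 1 < t)); trivial. apply open_gt.
      intros x Hx. unfold extend_ends.
      destruct (Rle_dec x (-1)); [lra|]. destruct (Rlt_dec x 1); lra.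
    + intros eps Heps. destruct (H2 eps Heps) as [d [Hd Hd']].
      exists (Rmin d 1). split; [apply Rmin_case; lra|].
      intros x [_ Hx]. simpl in Hx. unfold R_dist in Hx. apply Rabs_def2 in Hx.
      pose proof (Rmin_l d 1). pose proof (Rmin_r d 1).
      simpl. unfold R_dist, extend_ends.
      destruct (Rle_dec 1 (-1)); [lra|]. destruct (Rlt_dec 1 1); [lra|].
      destruct (Rle_dec x (-1)); [lra|]. destruct (Rlt_dec x 1).
      * apply Hd'. lra.
      * rewrite Rminus_eq_0, Rabs_R0. lra.
  - intros eps Heps. destruct (H1 eps Heps) as [d [Hd Hd']].
    exists (Rmin d 1). split; [apply Rmin_case; lra|].
    intros x [_ Hx]. simpl in Hx. unfold R_dist in Hx. apply Rabs_def2 in Hx.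
    pose proof (Rmin_l d 1). pose proof (Rmin_r d 1).
    simpl. unfold R_dist, extend_ends.
    destruct (Rle_dec (-1) (-1)); [|lra].
    destruct (Rle_dec x (-1)).
    + rewrite Rminus_eq_0, Rabs_R0. lra.
    + destruct (Rlt_dec x 1); [|lra].
      rewrite <- (Ropp_involutive x). apply Hd'. lra.
Qed.

(** Monotonicity is only assumed on the open half intervals; continuity at 0
    extends it to the peak, which is needed where f vanishes. *)
Lemma decreasing_on_closed (h : R -> R) :
  continuous h 0 -> decreasing_on h 0 1 ->
  forall s t, 0 <= s -> s <= t -> t < 1 -> h t <= h s.
Proof.
  intros Hc Hd s t Hs Hst Ht.
  destruct (Req_dec s 0) as [->|]; [|apply Hd; lra].
  destruct (Req_dec t 0) as [->|]; [lra|].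
  apply Rnot_lt_le. intros Hlt.
  destruct (proj1 (filterlim_locally h (h 0)) Hc (mkposreal _ (proj2 (Rlt_0_minus _ _) Hlt)))
    as [d Hball].
  set (x := Rmin (d / 2) (t / 2)).
  pose proof (cond_pos d) as Hd0.
  assert (Hxd : x <= d / 2) by apply Rmin_l.
  assert (Hxt : x <= t / 2) by apply Rmin_r.
  assert (Hx : 0 < x) by (apply Rmin_case; lra).
  specialize (Hball x). apply Rabs_def2 in Hball.
  - unfold minus, plus, opp in Hball; simpl in Hball.
    assert (h t <= h x) by (apply Hd; lra). lra.
  - apply Rabs_def1; unfold minus, plus, opp; simpl; lra.
Qed.

Lemma unimodal_up_to_peak (rho : R -> R) (s t : R) :
  unimodal_density rho ->
  (0 <= s <= t /\ t < 1 -> rho t <= rho s) /\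
  (-1 < s <= t /\ t <= 0 -> rho s <= rho t).
Proof.
  intros [[_ Hsm] [Hinc Hdec]].
  assert (Hc : continuous rho 0).
  { apply (ex_derive_continuous (V := R_NormedModule)). apply (Hsm 1%nat). lra. }
  split; intros Hst.
  - apply decreasing_on_closed; trivial; lra.
  - rewrite <- (Ropp_involutive s), <- (Ropp_involutive t).
    apply (decreasing_on_closed (fun x => rho (- x))); try lra.
    + apply continuous_comp. apply (continuous_opp (V := R_NormedModule)), continuous_id.
      now rewrite Ropp_0.
    + intros a b Ha Hab Hb. apply Hinc; lra.
Qed.

(** H is the affine image of a primitive with H(-1) = -1 and H(1) = 1.  The bounds on
    1 - H and 1 + H are mean value inequalities between t and the nearer end point
    with the derivative taken at its largest.  In the balanced case they combine
    with the mean value theorem between 0 and t to place H above its chord on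
    (0,1): the average of rho on (0,t) is at least rho(t), hence at least the one
    on (t,1); symmetrically H lies below its chord on (-1,0). *)
Lemma normalized_primitive (rho : R -> R) :
  unimodal_density rho ->
  exists (k : R) (H : R -> R), 0 < k /\
    (forall t, -1 < t < 1 -> is_derive H t (k * rho t)) /\
    (forall t, -1 < t < 1 -> -1 < H t < 1) /\
    (forall t, 0 <= t < 1 -> 1 - H t <= k * rho t * (1 - t)) /\
    (forall t, -1 < t <= 0 -> 1 + H t <= k * rho t * (1 + t)) /\
    (balanced rho -> H 0 = 0 /\ (forall t, 0 <= t < 1 -> t <= H t) /\
       (forall t, -1 < t <= 0 -> H t <= t)).
Proof.
  intros Hrho. destruct (unimodal_extension rho Hrho) as [sg [Hc He]].
  set (G := fun t => RInt sg 0 t).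
  assert (IS : forall a b, ex_RInt sg a b).
  { intros a b. apply (ex_RInt_continuous (V := R_CompleteNormedModule)). auto. }
  assert (DG : forall t, is_derive G t (sg t)).
  { intros t. apply (is_derive_RInt (V := R_NormedModule) sg G 0 t); trivial.
    apply filter_forall. intros x.
    apply (RInt_correct (V := R_CompleteNormedModule)), IS. }
  assert (MV : forall s t, s < t -> exists c, G t - G s = sg c * (t - s) /\ s < c < t).
  { intros s t Hst. apply (MVT_cor2 G sg s t Hst).
    intros c _. apply is_derive_Reals, DG. }
  assert (Hpos : forall t, -1 < t < 1 -> 0 < sg t).
  { intros t Ht. rewrite He by trivial. now apply Hrho. }
  assert (Ginc : forall s t, -1 <= s -> s < t -> t <= 1 -> G s < G t).
  { intros s t Hs Hst Ht. destruct (MV s t Hst) as [c [E Hc']].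
    assert (0 < sg c) by (apply Hpos; lra).
    assert (0 < sg c * (t - s)) by (apply Rmult_lt_0_compat; lra). lra. }
  assert (Hup : forall t, 0 <= t < 1 -> G 1 - G t <= rho t * (1 - t)).
  { intros t Ht. destruct (MV t 1 ltac:(lra)) as [c [-> Hc']].
    apply Rmult_le_compat_r; [lra|]. rewrite He by lra.
    apply (unimodal_up_to_peak rho t c Hrho). lra. }
  assert (Hdn : forall t, -1 < t <= 0 -> G t - G (-1) <= rho t * (1 + t)).
  { intros t Ht. destruct (MV (-1) t ltac:(lra)) as [c [-> Hc']].
    replace (t - -1) with (1 + t) by ring.
    apply Rmult_le_compat_r; [lra|]. rewrite He by lra.
    apply (unimodal_up_to_peak rho c t Hrho). lra. }
  assert (G0 : G 0 = 0) by exact (RInt_point (V := R_CompleteNormedModule) 0 sg).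
  set (D := G 1 - G (-1)).
  assert (HD : 0 < D) by (assert (G (-1) < G 1) by (apply Ginc; lra); unfold D; lra).
  exists (2 / D), (fun t => (2 * G t - (G 1 + G (-1))) / D).
  assert (HiD : 0 < 2 / D) by (apply Rdiv_lt_0_compat; lra).
  assert (E1 : forall t, 1 - (2 * G t - (G 1 + G (-1))) / D = 2 / D * (G 1 - G t))
    by (intros; unfold D in *; field; lra).
  assert (E2 : forall t, 1 + (2 * G t - (G 1 + G (-1))) / D = 2 / D * (G t - G (-1)))
    by (intros; unfold D in *; field; lra).
  split; [exact HiD|]. split; [|split; [|split; [|split]]].
  - intros t Ht. rewrite <- (He t Ht).
    auto_derive; [eexists; apply DG|].
    rewrite (is_derive_unique (fun x : R => G x) t _ (DG t)). field. lra.
  - intros t Ht.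
    assert (0 < 2 / D * (G 1 - G t)).
    { apply Rmult_lt_0_compat; trivial. assert (G t < G 1) by (apply Ginc; lra). lra. }
    assert (0 < 2 / D * (G t - G (-1))).
    { apply Rmult_lt_0_compat; trivial. assert (G (-1) < G t) by (apply Ginc; lra). lra. }
    rewrite <- E1 in H. rewrite <- E2 in H0. lra.
  - intros t Ht. rewrite E1, Rmult_assoc. apply Rmult_le_compat_l; [lra|]. now apply Hup.
  - intros t Ht. rewrite E2, Rmult_assoc. apply Rmult_le_compat_l; [lra|]. now apply Hdn.
  - intros Hbal.
    assert (B : G (-1) = - G 1).
    { unfold G, balanced in *.
      rewrite <- (opp_RInt_swap (V := R_CompleteNormedModule) sg (-1) 0) by apply IS.
      change (- RInt sg (-1) 0 = - RInt sg 0 1). f_equal.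
      transitivity (RInt rho (-1) 0).
      - apply RInt_ext. rewrite Rmin_left, Rmax_right by lra. intros x Hx. apply He. lra.
      - rewrite Hbal. apply RInt_ext. rewrite Rmin_left, Rmax_right by lra.
        intros x Hx. symmetry. apply He. lra. }
    assert (D1 : D = 2 * G 1) by (unfold D; rewrite B; ring).
    assert (EH : forall t, (2 * G t - (G 1 + G (-1))) / D = G t / G 1)
      by (intros; rewrite D1, B; field; lra).
    split; [|split].
    + rewrite EH, G0. field. lra.
    + intros t Ht. rewrite EH. apply Rle_div_r; [lra|].
      destruct (Req_dec t 0) as [->|Ht0]; [lra|].
      specialize (Hup t Ht). destruct (MV 0 t ltac:(lra)) as [c [E Hc']].
      rewrite He in E by lra.
      assert (rho t <= rho c) by (apply (unimodal_up_to_peak rho c t Hrho); lra).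
      assert (rho t * t <= rho c * t) by (apply Rmult_le_compat_r; lra).
      nra.
    + intros t Ht. rewrite EH. apply Rle_div_l; [lra|].
      destruct (Req_dec t 0) as [->|Ht0]; [lra|].
      specialize (Hdn t Ht). destruct (MV t 0 ltac:(lra)) as [c [E Hc']].
      rewrite He in E by lra.
      assert (rho t <= rho c) by (apply (unimodal_up_to_peak rho t c Hrho); lra).
      assert (rho t * (- t) <= rho c * (- t)) by (apply Rmult_le_compat_r; lra).
      nra.
Qed.

(** * Linearization of the real harmonic equation *)

Lemma locally_2d_in_disk (z : C) :
  in_disk z -> locally_2d (fun x y => in_disk (x, y)) (Re z) (Im z).
Proof.
  intros Hz. apply in_disk_Re_Im in Hz.
  assert (H : continuity_2d_pt (fun x y => x * x + y * y) (Re z) (Im z)).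
  { apply continuity_2d_pt_plus; apply continuity_2d_pt_mult;
      auto using continuity_2d_pt_id1, continuity_2d_pt_id2. }
  assert (He : 0 < 1 - (Re z * Re z + Im z * Im z)) by lra.
  generalize (H (mkposreal _ He)). apply locally_2d_impl, locally_2d_forall.
  intros x y Hxy. apply Rabs_def2 in Hxy. simpl in Hxy.
  apply in_disk_Re_Im. simpl. lra.
Qed.

Lemma C1_differentiable (h : C -> R) (z : C) :
  (forall z, in_disk z -> ex_diff_n (fun x y => h (x, y)) 1 (Re z) (Im z)) ->
  in_disk z ->
  differentiable_pt_lim (fun x y => h (x, y)) (Re z) (Im z) (partial_x h z) (partial_y h z).
Proof.
  intros Hh Hz.
  apply filterdiff_differentiable_pt_lim.
  apply (is_derive_filterdiff (fun x y => h (x, y)) (Re z) (Im z)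
           (fun x y => partial_x h (x, y)) (partial_y h z)).
  - apply (proj1 (locally_2d_locally
      (fun x y => is_derive (fun t : R => h (t, y)) x (partial_x h (x, y))) _ _)).
    generalize (locally_2d_in_disk z Hz). apply locally_2d_impl, locally_2d_forall.
    intros x y Hxy. apply Derive_correct. apply (Hh (x, y) Hxy).
  - apply Derive_correct. apply (Hh z Hz).
  - apply (continuity_2d_pt_filterlim (fun x y => partial_x h (x, y))).
    apply (Hh z Hz).
Qed.

Definition partial_xx (f : C -> R) := partial_x (partial_x f).
Definition partial_xy (f : C -> R) := partial_y (partial_x f).
Definition partial_yy (f : C -> R) := partial_y (partial_y f).

Lemma mixed_partials (f : C -> R) (z : C) :
  C2_on_disk f -> in_disk z -> partial_x (partial_y f) z = partial_xy f z.
Proof.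
  intros Hf Hz. apply (Schwarz (fun x y => f (x, y)) (Re z) (Im z)).
  - generalize (locally_2d_in_disk z Hz). apply locally_2d_impl, locally_2d_forall.
    intros x y Hxy. destruct (Hf (x, y) Hxy) as (_ & H1 & H2 & H3 & H4).
    simpl in *. tauto.
  - apply (Hf z Hz).
  - apply (Hf z Hz).
Qed.

Lemma C2_wirtinger (f : C -> R) (z : C) :
  C2_on_disk f -> in_disk z ->
  wirtinger f z (partial_x f z, - partial_y f z) /\
  wirtinger (partial_x f) z (partial_xx f z, - partial_xy f z) /\
  wirtinger (partial_y f) z (partial_xy f z, - partial_yy f z).
Proof.
  intros Hf Hz. repeat split.
  - refine (differentiable_pt_lim_eq _ _ _ _ _ _ _ (C1_differentiable f z _ Hz) _ _);
      [|simpl; ring..].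
    intros w Hw. apply (ex_diff_n_m 2 1); auto.
  - refine (differentiable_pt_lim_eq _ _ _ _ _ _ _ (C1_differentiable (partial_x f) z _ Hz) _ _);
      [|unfold partial_xx, partial_xy; simpl; ring..].
    intros w Hw. apply (Hf w Hw).
  - refine (differentiable_pt_lim_eq _ _ _ _ _ _ _ (C1_differentiable (partial_y f) z _ Hz) _ _).
    + intros w Hw. apply (Hf w Hw).
    + simpl. now apply mixed_partials.
    + unfold partial_yy. simpl. ring.
Qed.

(** The gradient of H o f is k rho(f) grad f.  With a and b its second derivatives
    in xx and xy, the equation for f says that the one in yy is - a, so that
    a - i b is the complex derivative of the holomorphic gradient. *)
Lemma real_harmonic_linearization (rho H : R -> R) (f : C -> R) (k : R) :
  smooth_density rho -> real_harmonic rho f ->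
  (forall t, -1 < t < 1 -> is_derive H t (k * rho t)) ->
  exists g', harmonic (fun z => H (f z))
    (fun z => RtoC (k * rho (f z)) * (partial_x f z, (- partial_y f z)%R))%C g'.
Proof.
  intros [Hpos Hsm] (Hran & Hf & Heq) HH.
  set (a := fun z => k * (Derive rho (f z) * partial_x f z ^ 2 + rho (f z) * partial_xx f z)).
  set (b := fun z => k * (Derive rho (f z) * partial_x f z * partial_y f z
                          + rho (f z) * partial_xy f z)).
  exists (fun z => (a z, - b z)).
  intros z Hz. specialize (Heq z Hz). assert (Hr := Hran z Hz).
  destruct (C2_wirtinger f z Hf Hz) as (W0 & W1 & W2).
  assert (Wr : wirtinger (fun z => k * rho (f z)) z
                 (RtoC (k * Derive rho (f z)) * (partial_x f z, (- partial_y f z)%R))%C).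
  { apply (wirtinger_real_comp (fun t => k * rho t)); trivial.
    apply is_derive_scal, Derive_correct. exact (Hsm 1%nat _ Hr). }
  assert (Hyy : a z = - (k * (Derive rho (f z) * partial_y f z ^ 2 + rho (f z) * partial_yy f z))).
  { assert (Hp := Hpos _ Hr).
    change (laplacian f z) with (partial_xx f z + partial_yy f z) in Heq.
    unfold grad_norm in Heq. rewrite pow2_sqrt in Heq by nra.
    assert (E : partial_xx f z = - partial_yy f z
      - Derive rho (f z) / rho (f z) * (partial_x f z ^ 2 + partial_y f z ^ 2)) by lra.
    unfold a. rewrite E. field. lra. }
  assert (Cr : continuity_2d_pt (fun x y => rho (f (x, y))) (Re z) (Im z)).
  { apply (continuity_2d_pt_comp_1d rho (fun x y => f (x, y))).
    - destruct z. apply (ex_derive_continuous (V := R_NormedModule)). exact (Hsm 1%nat _ Hr).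
    - exact (wirtinger_continuity _ _ _ W0). }
  assert (Cr' : continuity_2d_pt (fun x y => Derive rho (f (x, y))) (Re z) (Im z)).
  { apply (continuity_2d_pt_comp_1d (Derive rho) (fun x y => f (x, y))).
    - destruct z. apply (ex_derive_continuous (V := R_NormedModule)). exact (Hsm 2%nat _ Hr).
    - exact (wirtinger_continuity _ _ _ W0). }
  assert (Cx := wirtinger_continuity _ _ _ W1). assert (Cy := wirtinger_continuity _ _ _ W2).
  assert (Cxx : continuity_2d_pt (fun x y => partial_xx f (x, y)) (Re z) (Im z))
    by apply (Hf z Hz).
  assert (Cxy : continuity_2d_pt (fun x y => partial_xy f (x, y)) (Re z) (Im z))
    by apply (Hf z Hz).
  repeat split.
  - apply wirtinger_eq with (1 := wirtinger_real_comp H _ f z _ (HH _ Hr) W0). reflexivity.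
  - apply (wirtinger_ext (fun z => (k * rho (f z)) * partial_x f z)).
    { intros w. simpl. ring. }
    apply wirtinger_eq with (1 := wirtinger_mult _ _ _ _ _ Wr W1).
    apply C_eq; unfold a, b, Re, Im; simpl; ring.
  - apply (wirtinger_ext (fun z => -1 * ((k * rho (f z)) * partial_y f z))).
    { intros w. simpl. ring. }
    apply wirtinger_eq with (1 := wirtinger_scal (-1) _ _ _ (wirtinger_mult _ _ _ _ _ Wr W2)).
    rewrite Hyy. apply C_eq; unfold b, Re, Im; simpl; ring.
  - apply continuity_2d_pt_mult; [apply continuity_2d_pt_const|].
    apply continuity_2d_pt_plus; apply continuity_2d_pt_mult; trivial.
    apply continuity_2d_pt_mult; trivial. apply continuity_2d_pt_mult; trivial.
    apply continuity_2d_pt_const.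
  - apply continuity_2d_pt_opp.
    apply continuity_2d_pt_mult; [apply continuity_2d_pt_const|].
    apply continuity_2d_pt_plus; repeat apply continuity_2d_pt_mult; trivial.
Qed.

(** * The two estimates *)

Lemma Cmod_linearized_gradient (a p q : R) :
  0 <= a -> Cmod (RtoC a * (p, (- q)%R))%C = a * sqrt (p ^ 2 + q ^ 2).
Proof.
  intros Ha. rewrite Cmod_mult, Cmod_R, Rabs_right by lra.
  f_equal. unfold Cmod; simpl fst; simpl snd. f_equal. ring.
Qed.

(** Combines cos (pi u / 2) <= (pi/2) (1 - |u|) with the comparison of 1 - |H(f)| and
    k rho(f) (1 - |f|), on the side of 0 where f(z) lies. *)
Theorem gradient_estimate (rho : R -> R) (f : C -> R) (z : C) :
  admissible rho f -> in_disk z ->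
  grad_norm f z <= 2 * ((1 - Rabs (f z)) / (1 - Cmod z ^ 2)).
Proof.
  intros [Hrho Hf] Hz.
  destruct (normalized_primitive rho Hrho) as (k & H & Hk & HH & Hb & Hup & Hdn & _).
  destruct (real_harmonic_linearization rho H f k (proj1 Hrho) Hf HH) as [g' Hu].
  assert (Hr : forall w, in_disk w -> -1 < f w < 1) by apply Hf.
  assert (K := harmonic_gradient_bound _ _ _ z Hu
    (fun w Hw => conj (Rlt_le _ _ (proj1 (Hb _ (Hr w Hw))))
                      (Rlt_le _ _ (proj2 (Hb _ (Hr w Hw))))) Hz).
  cbv beta in K. specialize (Hr z Hz).
  assert (Hp : 0 < k * rho (f z)) by (apply Rmult_lt_0_compat; trivial; now apply Hrho).
  rewrite Cmod_linearized_gradient in K by lra.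
  change (sqrt _) with (grad_norm f z) in K.
  pose proof PI_RGT_0 as Hpi.
  assert (Hz2 : 0 < 1 - Cmod z ^ 2).
  { unfold in_disk in Hz. pose proof (Cmod_ge_0 z). nra. }
  assert (Hcos : forall x, 0 <= x -> cos (PI / 2 - x) <= x).
  { intros x Hx. rewrite cos_shift. destruct (Req_dec x 0) as [->|].
    - rewrite sin_0. lra.
    - apply Rlt_le, sin_lt_x. lra. }
  specialize (Hb _ Hr).
  assert (H1 : cos (PI / 2 * H (f z)) <= PI / 2 * (1 - H (f z))).
  { replace (PI / 2 * H (f z)) with (PI / 2 - PI / 2 * (1 - H (f z))) by ring.
    apply Hcos. apply Rmult_le_pos; lra. }
  assert (H2 : cos (PI / 2 * H (f z)) <= PI / 2 * (1 + H (f z))).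
  { rewrite <- cos_neg.
    replace (- (PI / 2 * H (f z))) with (PI / 2 - PI / 2 * (1 + H (f z))) by ring.
    apply Hcos. apply Rmult_le_pos; lra. }
  unfold Rdiv. rewrite <- Rmult_assoc.
  apply Rle_div_r; [lra|].
  apply Rmult_le_reg_l with (1 := Hp). apply Rmult_le_reg_l with (1 := Hpi).
  apply Rle_trans with (PI * (k * rho (f z) * grad_norm f z * (1 - Cmod z ^ 2))).
  { right. ring. }
  apply Rle_trans with (1 := K).
  destruct (Rle_lt_dec 0 (f z)) as [Hf0|Hf0].
  - rewrite Rabs_right by lra.
    assert (1 - H (f z) <= k * rho (f z) * (1 - f z)) by (apply Hup; lra). nra.
  - rewrite Rabs_left by lra.
    assert (1 + H (f z) <= k * rho (f z) * (1 + f z)) by (apply Hdn; lra). nra.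
Qed.

Theorem schwarz_estimate (rho : R -> R) (f : C -> R) (z : C) :
  admissible_normalized rho f -> in_disk z ->
  Rabs (f z) <= 4 / PI * atan (Cmod z).
Proof.
  intros [[Hrho Hf] [Hf0 Hbal]] Hz.
  destruct (normalized_primitive rho Hrho) as (k & H & Hk & HH & Hb & _ & _ & Hn).
  destruct (Hn Hbal) as (H0 & Hup & Hdn).
  destruct (real_harmonic_linearization rho H f k (proj1 Hrho) Hf HH) as [g' Hu].
  assert (Hr : forall w, in_disk w -> -1 < f w < 1) by apply Hf.
  assert (K := harmonic_schwarz _ _ _ z Hu (fun w Hw => Hb _ (Hr w Hw))).
  cbv beta in K. rewrite Hf0 in K. apply Rle_trans with (2 := K H0 Hz).
  specialize (Hr z Hz).
  destruct (Rle_lt_dec 0 (f z)) as [Hz0|Hz0].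
  - assert (f z <= H (f z)) by (apply Hup; lra). rewrite !Rabs_right; lra.
  - assert (H (f z) <= f z) by (apply Hdn; lra). rewrite !Rabs_left; lra.
Qed.

(** * Extremal functions *)
Lemma wirtinger_partials (u : C -> R) (z l : C) :
  wirtinger u z l ->
  is_derive (fun x => u (x, Im z)) (Re z) (Re l) /\
  is_derive (fun y => u (Re z, y)) (Im z) (- Im l).
Proof.
  intros Hu. split.
  - refine (is_derive_eq _ _ _ _ (wirtinger_curve u l (fun x => x) (fun _ => Im z) (Re z) 1 0
      Hu (is_derive_id _) (is_derive_const _ _)) _). ring.
  - refine (is_derive_eq _ _ _ _ (wirtinger_curve u l (fun _ => Re z) (fun y => y) (Im z) 0 1
      Hu (is_derive_const _ _) (is_derive_id _)) _). ring.
Qed.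

Lemma partial_x_wirtinger (u : C -> R) (z l : C) : wirtinger u z l -> partial_x u z = Re l.
Proof. intros H. apply is_derive_unique, (wirtinger_partials _ _ _ H). Qed.

Lemma partial_y_wirtinger (u : C -> R) (z l : C) : wirtinger u z l -> partial_y u z = - Im l.
Proof. intros H. apply is_derive_unique, (wirtinger_partials _ _ _ H). Qed.

Lemma grad_norm_wirtinger (u : C -> R) (z l : C) : wirtinger u z l -> grad_norm u z = Cmod l.
Proof.
  intros H. unfold grad_norm, Cmod.
  rewrite (partial_x_wirtinger _ _ _ H), (partial_y_wirtinger _ _ _ H).
  f_equal. unfold Re, Im. ring.
Qed.

Lemma wirtinger_C1 (u : C -> R) (g : C -> C) (z : C) :
  (forall z, in_disk z -> wirtinger u z (g z)) -> continuous_C g z -> in_disk z ->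
  ex_diff_n (fun x y => u (x, y)) 1 (Re z) (Im z).
Proof.
  intros Hu [C1 C2] Hz. destruct (wirtinger_partials _ _ _ (Hu z Hz)) as [D1 D2].
  split; [exact (wirtinger_continuity _ _ _ (Hu z Hz))|].
  split; [eexists; exact D1|]. split; [eexists; exact D2|]. split; split; trivial.
  - apply continuity_2d_pt_ext_loc with (2 := C1).
    generalize (locally_2d_in_disk z Hz). apply locally_2d_impl, locally_2d_forall.
    intros x y Hxy. symmetry. exact (partial_x_wirtinger _ _ _ (Hu _ Hxy)).
  - apply continuity_2d_pt_ext_loc with (2 := continuity_2d_pt_opp _ _ _ C2).
    generalize (locally_2d_in_disk z Hz). apply locally_2d_impl, locally_2d_forall.
    intros x y Hxy. symmetry. exact (partial_y_wirtinger _ _ _ (Hu _ Hxy)).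
Qed.

Lemma harmonic_C2 (u : C -> R) (g g' : C -> C) : harmonic u g g' -> C2_on_disk u.
Proof.
  intros Hu z Hz. destruct (Hu z Hz) as (W & G & Cg').
  destruct (wirtinger_partials _ _ _ W) as [D1 D2].
  split; [exact (wirtinger_continuity _ _ _ W)|].
  split; [eexists; exact D1|]. split; [eexists; exact D2|]. split.
  - apply ex_diff_n_ext_loc with (fun x y => Re (g (x, y))).
    + generalize (locally_2d_in_disk z Hz). apply locally_2d_impl, locally_2d_forall.
      intros x y Hxy. symmetry. exact (partial_x_wirtinger _ _ _ (proj1 (Hu _ Hxy))).
    + apply (wirtinger_C1 (fun z => Re (g z)) g'); trivial. intros w Hw. apply Hu, Hw.
  - apply ex_diff_n_ext_loc with (fun x y => (- Im (g (x, y)))).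
    + generalize (locally_2d_in_disk z Hz). apply locally_2d_impl, locally_2d_forall.
      intros x y Hxy. symmetry. exact (partial_y_wirtinger _ _ _ (proj1 (Hu _ Hxy))).
    + apply (wirtinger_C1 (fun z => - Im (g z)) (fun z => Ci * g' z)%C); trivial.
      * intros w Hw. destruct (Hu w Hw) as (_ & [_ HI] & _).
        apply wirtinger_scal with (c := -1) in HI.
        apply (wirtinger_ext (fun w => -1 * Im (g w))); [intros; ring|].
        apply wirtinger_eq with (1 := HI). C_ring.
      * apply (continuous_C_mult (fun _ => Ci)); trivial. exact (holo_continuous_C _ _ _ (holo_const Ci z)).
Qed.

Lemma partials_ext_disk (u v : C -> R) (z : C) :
  (forall z, in_disk z -> u z = v z) -> in_disk z ->
  partial_x u z = partial_x v z /\ partial_y u z = partial_y v z.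
Proof.
  intros E Hz. assert (L := locally_2d_in_disk z Hz). split; apply Derive_ext_loc.
  - generalize (locally_2d_1d_const_y _ _ _ L). apply filter_imp. intros t Ht. now apply E.
  - generalize (locally_2d_1d_const_x _ _ _ L). apply filter_imp. intros t Ht. now apply E.
Qed.

Lemma harmonic_laplacian (u : C -> R) (g g' : C -> C) (z : C) :
  harmonic u g g' -> in_disk z -> laplacian u z = 0.
Proof.
  intros Hu Hz. destruct (Hu z Hz) as (_ & [G1 G2] & _).
  change (laplacian u z) with (partial_x (partial_x u) z + partial_y (partial_y u) z).
  rewrite (proj1 (partials_ext_disk (partial_x u) (fun z => Re (g z)) z
    (fun w Hw => partial_x_wirtinger _ _ _ (proj1 (Hu w Hw))) Hz)).
  rewrite (proj2 (partials_ext_disk (partial_y u) (fun z => - Im (g z)) z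
    (fun w Hw => partial_y_wirtinger _ _ _ (proj1 (Hu w Hw))) Hz)).
  rewrite (partial_x_wirtinger _ _ _ G1).
  apply wirtinger_scal with (c := -1) in G2.
  apply (wirtinger_ext _ (fun w => - Im (g w))) in G2; [|intros; ring].
  rewrite (partial_y_wirtinger _ _ _ G2). unfold Re, Im; simpl. ring.
Qed.

Lemma harmonic_admissible (u : C -> R) (g g' : C -> C) :
  harmonic u g g' -> (forall z, in_disk z -> -1 < u z < 1) -> u (RtoC 0) = 0 ->
  admissible_normalized (fun _ => 1) u.
Proof.
  intros Hu Hb H0. split; [split; [|split; [|split]]|split].
  - split; [split|split].
    + intros; lra.
    + intros n t _. apply ex_derive_n_const.
    + intros s t _ _ _. lra.
    + intros s t _ _ _. lra.
  - exact Hb.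
  - exact (harmonic_C2 u g g' Hu).
  - intros z Hz. rewrite (harmonic_laplacian u g g' z Hu Hz), Derive_const.
    unfold Rdiv. ring.
  - exact H0.
  - unfold balanced. rewrite !RInt_const. unfold scal; simpl; unfold mult; simpl. ring.
Qed.

(** The function (4/pi) arctan w maps the disk conformally onto the strip
    |Re| < 1.  This is its real part, in a form that makes the range evident. *)
Definition extremal (w : C) : R :=
  2 / PI * atan (2 * Re w * / (1 - (Re w ^ 2 + Im w ^ 2))).

Definition extremal_gradient (w : C) : C := (RtoC (4 / PI) * / (1 + w * w))%C.

Lemma one_plus_sqr_neq_0 (w : C) : in_disk w -> (1 + w * w)%C <> RtoC 0.
Proof.
  intros Hw E. apply in_disk_Re_Im in Hw. injection E as E1 E2.
  destruct w as [x y]; simpl in *. nra.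
Qed.

Lemma extremal_wirtinger (w : C) :
  in_disk w -> wirtinger extremal w (extremal_gradient w).
Proof.
  intros Hw. assert (Hn0 := one_plus_sqr_neq_0 w Hw). apply in_disk_Re_Im in Hw.
  pose proof PI_RGT_0 as Hpi.
  destruct (holo_id w) as [Wx Wy].
  set (N := fun w => 2 * Re w).
  set (D := fun w => 1 - (Re w ^ 2 + Im w ^ 2)).
  assert (WN : wirtinger N w (2 * 1)%C) by exact (wirtinger_scal 2 _ _ _ Wx).
  assert (WD : wirtinger D w (-2 * Re w, 2 * Im w)).
  { apply (wirtinger_ext (fun w => 1 * 1 + -1 * (1 * (Re w * Re w) + 1 * (Im w * Im w)))).
    { intros v. unfold D. ring. }
    refine (wirtinger_eq _ _ _ _ (wirtinger_linear 1 (-1) _ _ _ _ _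
      (wirtinger_const 1 w) (wirtinger_linear 1 1 _ _ _ _ _
      (wirtinger_mult _ _ _ _ _ Wx Wx) (wirtinger_mult _ _ _ _ _ Wy Wy))) _).
    C_ring. }
  assert (HD : 0 < D w) by (unfold D; lra).
  assert (WiD : wirtinger (fun w => / D w) w
     (RtoC (- / D w ^ 2) * (-2 * Re w, 2 * Im w)%R)%C).
  { apply (wirtinger_real_comp Rinv); trivial. auto_derive; [lra|field; lra]. }
  assert (WQ := wirtinger_mult _ _ _ _ _ WN WiD).
  assert (Da : is_derive (fun x => 2 / PI * atan x) (N w * / D w)
     (2 / PI * / (1 + (N w * / D w) ^ 2))).
  { auto_derive; trivial. unfold Rsqr. field. split; nra. }
  refine (wirtinger_eq _ _ _ _ (wirtinger_real_comp _ _ _ _ _ Da WQ) _).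
  unfold extremal_gradient.
  destruct w as [x y]. unfold N, D, Re, Im in *. simpl fst in *. simpl snd in *.
  assert (Q : 0 < (1 - (x ^ 2 + y ^ 2)) ^ 2 + (2 * x) ^ 2) by nra.
  apply C_eq; unfold Re, Im; simpl; field; repeat split; try lra; nra.
Qed.

Lemma extremal_harmonic :
  harmonic extremal extremal_gradient
    (fun w => RtoC (4 / PI) * (- ((1 * w + w * 1) * (/ (1 + w * w) * / (1 + w * w)))))%C.
Proof.
  intros w Hw. assert (Hn0 := one_plus_sqr_neq_0 w Hw).
  split; [now apply extremal_wirtinger|].
  assert (Hsq : holo (fun w => 1 + 1 * (w * w))%C w (1 * (1 * w + w * 1))%C).
  { apply (holo_comp (fun v => 1 + 1 * v)%C (fun v => v * v)%C).
    - apply holo_affine.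
    - apply holo_mult; apply holo_id. }
  assert (Hs : holo (fun w => 1 + w * w)%C w (1 * w + w * 1)%C).
  { apply (holo_ext (fun w => 1 + 1 * (w * w))%C); [intros; ring|].
    apply holo_eq with (1 := Hsq). ring. }
  assert (Hi := holo_inv (fun w => 1 + w * w)%C w _ Hn0 Hs).
  assert (Ci' := holo_continuous_C _ _ _ Hi).
  split.
  - refine (holo_eq _ _ _ _ (holo_mult _ _ _ _ _ (holo_const (RtoC (4 / PI)) w) Hi) _). ring.
  - refine (continuous_C_mult (fun _ => RtoC (4 / PI))
      (fun w => - ((1 * w + w * 1) * (/ (1 + w * w) * / (1 + w * w))))%C w _ _).
    + exact (holo_continuous_C _ _ _ (holo_const _ w)).
    + assert (C2 : continuous_C (fun w => (-1 * (1 * w + w * 1)) * (/ (1 + w * w) * / (1 + w * w)))%C w).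
      { refine (continuous_C_mult (fun w => (-1 * (1 * w + w * 1)))%C
          (fun w => / (1 + w * w) * / (1 + w * w))%C w _ (continuous_C_mult _ _ _ Ci' Ci')).
        apply (holo_continuous_C _ _ (-2)%C). apply (holo_ext (fun w => 0 + (-2) * w)%C).
        - intros v. ring.
        - apply holo_affine. }
      destruct C2 as [H1 H2]. split.
      * apply continuity_2d_pt_ext with (2 := H1). intros x y. f_equal. ring.
      * apply continuity_2d_pt_ext with (2 := H2). intros x y. f_equal. ring.
Qed.

Lemma extremal_bound (w : C) : -1 < extremal w < 1.
Proof.
  unfold extremal. set (x := 2 * _ * _). destruct (atan_bound x). pose proof PI_RGT_0.
  assert (E : forall a, 2 / PI * a = a / (PI / 2)) by (intros; field; lra).
  rewrite E. split.
  - apply Rlt_div_r; lra.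
  - apply Rlt_div_l; lra.
Qed.

Lemma extremal_real (t : R) : 0 <= t < 1 -> extremal (RtoC t) = 4 / PI * atan t.
Proof.
  intros Ht. unfold extremal. simpl Re. simpl Im. pose proof PI_RGT_0.
  replace (4 / PI * atan t) with (2 / PI * (2 * atan t)) by (field; lra). f_equal.
  assert (Hat : 0 <= atan t < PI / 4).
  { split.
    - rewrite <- atan_0. destruct (Req_dec t 0) as [->|]; [lra|].
      apply Rlt_le, atan_increasing. lra.
    - rewrite <- atan_1. apply atan_increasing. lra. }
  rewrite <- (atan_tan (2 * atan t)) by lra. f_equal.
  rewrite tan_2a, tan_atan; [field; nra|..].
  - apply Rgt_not_eq, cos_gt_0; lra.
  - apply Rgt_not_eq, cos_gt_0; lra.
  - rewrite tan_atan. nra.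
Qed.

(** At a real point s the extremal function has gradient (4/pi) / (1 + s^2), and
    the ratio of this to (4/pi) (pi/4 - atan s) / (1 - s^2) is at least 1 + s, because
    pi/4 - atan s <= (1 - s) / (1 + s^2). *)
Theorem gradient_estimate_sharp (K : R) :
  K < 2 ->
  exists (rho : R -> R) (f : C -> R) (z : C), admissible rho f /\ in_disk z /\
    K * ((1 - Rabs (f z)) / (1 - Cmod z ^ 2)) < grad_norm f z.
Proof.
  intros HK. pose proof PI_RGT_0 as Hpi.
  (* Close enough to 1 for K < 1 + s. *)
  set (s := 1 - Rmin (1 / 2) ((2 - K) / 2)).
  assert (Hs : 1 / 2 <= s < 1 /\ 2 * (1 - s) <= 2 - K).
  { unfold s. pose proof (Rmin_l (1 / 2) ((2 - K) / 2)).
    pose proof (Rmin_r (1 / 2) ((2 - K) / 2)).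
    assert (0 < Rmin (1 / 2) ((2 - K) / 2)) by (apply Rmin_case; lra). lra. }
  assert (Hin : in_disk (RtoC s)).
  { unfold in_disk. rewrite Cmod_R, Rabs_right; lra. }
  exists (fun _ => 1), extremal, (RtoC s). split; [|split; trivial].
  { apply (harmonic_admissible _ _ _ extremal_harmonic).
    - intros. apply extremal_bound.
    - rewrite extremal_real, atan_0 by lra. ring. }
  rewrite (grad_norm_wirtinger _ _ _ (extremal_wirtinger _ Hin)).
  rewrite extremal_real, Cmod_R by lra. rewrite (Rabs_right s) by lra.
  assert (Hat : 0 <= atan s < PI / 4).
  { split.
    - rewrite <- atan_0. apply Rlt_le, atan_increasing. lra.
    - rewrite <- atan_1. apply atan_increasing. lra. }
  assert (E : Cmod (extremal_gradient (RtoC s)) = 4 / PI / (1 + s ^ 2)).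
  { unfold extremal_gradient. rewrite <- RtoC_mult, <- RtoC_plus.
    rewrite Cmod_mult, Cmod_inv, !Cmod_R.
    - assert (0 < 4 / PI) by (apply Rdiv_lt_0_compat; lra).
      rewrite !Rabs_right by nra. field. split; nra.
    - intros H. injection H. nra. }
  rewrite E.
  assert (H1 : PI / 4 - atan s <= (1 - s) / (1 + s ^ 2)).
  { rewrite <- atan_1.
    destruct (MVT_cor2 atan (fun x => / (1 + x ^ 2)) s 1) as [c [-> Hc]]; [lra| |].
    - intros c _. apply is_derive_Reals. auto_derive; trivial. unfold Rsqr. field. nra.
    - rewrite Rmult_comm. apply Rmult_le_compat_l; [lra|]. apply Rinv_le_contravar; nra. }
  set (A := (1 - Rabs (4 / PI * atan s)) / (1 - s ^ 2)).
  assert (E1 : 1 - Rabs (4 / PI * atan s) = 4 / PI * (PI / 4 - atan s)).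
  { rewrite Rabs_right; [field; lra|]. apply Rle_ge, Rmult_le_pos; [|lra].
    apply Rlt_le, Rdiv_lt_0_compat; lra. }
  assert (H4 : 0 < 4 / PI) by (apply Rdiv_lt_0_compat; lra).
  assert (HA : 0 < A).
  { unfold A. rewrite E1. apply Rdiv_lt_0_compat; [|nra].
    apply Rmult_lt_0_compat; lra. }
  apply Rlt_le_trans with ((1 + s) * A).
  - apply Rmult_lt_compat_r; lra.
  - unfold A. rewrite E1.
    replace ((1 + s) * (4 / PI * (PI / 4 - atan s) / (1 - s ^ 2)))
      with (4 / PI * ((PI / 4 - atan s) / (1 - s))) by (field; split; nra).
    unfold Rdiv at 4. apply Rmult_le_compat_l; [lra|].
    apply Rle_div_l; [lra|]. rewrite Rmult_comm. exact H1.
Qed.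

(** The extremal function precomposed with the rotation taking z to |z|. *)
Theorem schwarz_estimate_sharp (z : C) :
  in_disk z ->
  exists (rho : R -> R) (f : C -> R), admissible_normalized rho f /\
    f z = 4 / PI * atan (Cmod z).
Proof.
  intros Hz.
  assert (He : exists e, Cmod e = 1 /\ (0 + e * z)%C = RtoC (Cmod z)).
  { destruct (Ceq_dec z 0) as [->|Hz0].
    - exists 1%C. rewrite Cmod_1, Cmod_0. split; trivial. ring.
    - assert (Hn : Cmod z <> 0) by (intros E; now apply Hz0, Cmod_eq_0).
      assert (Hn' : RtoC (Cmod z) <> 0) by (intros E; injection E; trivial).
      exists (Cconj z * / Cmod z)%C. split.
      + rewrite Cmod_mult, Cmod_inv, Cmod_conj, Cmod_R by trivial.
        rewrite Rabs_right by (apply Rle_ge, Cmod_ge_0). now apply Rinv_r.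
      + transitivity ((z * Cconj z) * / Cmod z)%C; [ring|].
        replace (z * Cconj z)%C with (Cmod z * Cmod z)%C; [now field|].
        rewrite <- RtoC_mult. replace (Cmod z * Cmod z) with (Cmod z ^ 2) by ring.
        rewrite Cmod_sqr. C_ring. }
  destruct He as (e & He & Hez).
  exists (fun _ => 1), (fun z => extremal (0 + e * z)%C). split.
  - eapply harmonic_admissible.
    + apply harmonic_comp with (phi' := fun _ => e) (phi'' := fun _ => 0%C).
      exact extremal_harmonic.
      intros w Hw. split; [|split; [|split]].
      * unfold in_disk. now rewrite Cplus_0_l, Cmod_mult, He, Rmult_1_l.
      * apply holo_affine.
      * apply holo_const.
      * exact (holo_continuous_C _ _ _ (holo_const 0 w)).
    + intros w _. apply extremal_bound.
    + replace (0 + e * 0)%C with (RtoC 0) by ring.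
      rewrite extremal_real, atan_0 by lra. ring.
  - cbv beta. rewrite Hez. apply extremal_real. split; [apply Cmod_ge_0|exact Hz].
Qed.

Theorem theorem1p5 :
  (forall (rho : R -> R) (f : C -> R), admissible rho f ->
     forall z : C, in_disk z ->
       grad_norm f z <= 2 * ((1 - Rabs (f z)) / (1 - Cmod z ^ 2))) /\
  (forall K : R, K < 2 ->
     ~ (forall (rho : R -> R) (f : C -> R), admissible rho f ->
          forall z : C, in_disk z ->
            grad_norm f z <= K * ((1 - Rabs (f z)) / (1 - Cmod z ^ 2)))) /\
  (forall (rho : R -> R) (f : C -> R), admissible_normalized rho f ->
     forall z : C, in_disk z -> Rabs (f z) <= 4 / PI * atan (Cmod z)) /\
  (forall z : C, in_disk z ->
     forall M : R, M < 4 / PI * atan (Cmod z) ->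
       ~ (forall (rho : R -> R) (f : C -> R), admissible_normalized rho f ->
            Rabs (f z) <= M)).
Proof.
  split; [|split; [|split]].
  - intros rho f Hf z Hz. now apply (gradient_estimate rho).
  - intros K HK Hall.
    destruct (gradient_estimate_sharp K HK) as (rho & f & z & Hf & Hz & Hlt).
    specialize (Hall rho f Hf z Hz). lra.
  - intros rho f Hf z Hz. now apply (schwarz_estimate rho).
  - intros z Hz M HM Hall.
    destruct (schwarz_estimate_sharp z Hz) as (rho & f & Hf & E).
    specialize (Hall rho f Hf). pose proof (Rle_abs (f z)). lra.
Qed.
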